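(* Let $G$ be an outerplanar graph. Then $o(G)=\mathcal{D}$ if and only if $G$ admits a perfect $[1,2]$-factor.
   Context: All graphs are finite and simple. A graph is outerplanar if it has a planar drawing in which all the vertices belong to the outer face. A perfect $[1,2]$-factor of a graph $G$ is a spanning subgraph of $G$ (a subgraph with the same vertex set) each of whose connected components is either a single edge $K_2$ or a cycle $C_n$, $n\ge 3$. The Maker-Breaker domination game on a graph $G$: two players, Dominator and Staller, alternately claim a not-yet-claimed vertex of $G$. Dominator wins if at some point the vertices she has claimed form a dominating set of $G$. Otherwise, i.e. if Staller manages to claim a vertex and all its neighbors, Staller wins. The graph $G$ has outcome $\mathcal{D}$, written $o(G)=\mathcal{D}$, if Dominator has a winning strategy whoever starts (equivalently, if Dominator has a winning strategy when playing second, since no player benefits from skipping a turn). *)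

(* Defs.v *)
From HB Require Import structures.
From mathcomp Require Import all_boot all_order all_algebra.
From mathcomp Require Import all_classical all_reals all_analysis.

Set Implicit Arguments.
Unset Strict Implicit.
Unset Printing Implicit Defensive.

Import Order.TTheory GRing.Theory Num.Theory.
Import numFieldNormedType.Exports.

(* A simple graph on V : finType is given by a symmetric irreflexive adjacency
   relation e : rel V. *)

Section Outerplanar.
Local Open Scope classical_set_scope.
Local Open Scope ring_scope.
Variable R : realType.

Notation plane := (R * R)%type.

Definition is_arc (a b : plane) (A : set plane) : Prop :=
  exists f : R -> plane,
    [/\ {within `[0, 1], continuous f}, set_inj `[0, 1] f, f 0 = a, f 1 = b
      & f @` `[0, 1] = A].

Variables (V : finType) (e : rel V).

(* The vertex v is drawn as the point p v and the edge xy as the arc A x y;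
   the values of A on non-adjacent pairs are irrelevant. *)
Record planar_drawing (p : V -> plane) (A : V -> V -> set plane) : Prop := {
  drawing_vertex_inj : injective p;
  drawing_edge_arc : forall x y, e x y -> is_arc (p x) (p y) (A x y);
  drawing_edge_sym : forall x y, e x y -> A x y = A y x;
  drawing_edge_vertex : forall x y z,
    e x y -> A x y (p z) -> z = x \/ z = y;
  drawing_edge_edge : forall x y x' y' (q : plane),
    e x y -> e x' y' -> [set x; y]%SET != [set x'; y']%SET ->
    A x y q -> A x' y' q ->
    exists z, [/\ z \in [set x; y]%SET, z \in [set x'; y']%SET & q = p z]
}.

Definition drawing_support (p : V -> plane) (A : V -> V -> set plane) :
    set plane :=
  range p `|` [set q | exists x y, e x y /\ A x y q].

Definition is_face (D F : set plane) : Prop :=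
  exists2 q, (~` D) q & F = connected_component (~` D) q.

(* D is compact for a drawing of a finite graph, so that exactly one face
   is unbounded. *)
Definition is_outer_face (D F : set plane) : Prop :=
  is_face D F /\ ~ bounded_set F.

(* A face is open and disjoint from the drawing: a vertex belongs to it in the
   sense of lying on its boundary. *)
Definition outerplanar : Prop :=
  exists p A, planar_drawing p A /\
    exists2 F, is_outer_face (drawing_support p A) F &
      forall v, closure F (p v).

End Outerplanar.

Section Factor.
Variable V : finType.

Definition K2_rel : rel 'I_2 := fun i j => i != j.

Definition cycle_rel (n : nat) : rel 'I_n :=
  fun i j => (j == i.+1 %% n :> nat) || (i == j.+1 %% n :> nat).

(* The connected component of x in the graph f is isomorphic to ('I_n, r). *)
Definition component_iso (f : rel V) (x : V) (n : nat) (r : rel 'I_n) : Prop :=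
  exists g : 'I_n -> V,
    [/\ injective g,
        forall y, connect f x y <-> exists i, g i = y
      & forall i j, f (g i) (g j) = r i j].

Definition perfect_12_factor (e f : rel V) : Prop :=
  [/\ symmetric f, subrel f e
    & forall x, component_iso f x K2_rel \/
                exists2 n, 3 <= n & component_iso f x (@cycle_rel n)].

End Factor.

Inductive player := Dominator | Staller.

Definition opponent (P : player) : player :=
  if P is Dominator then Staller else Dominator.

Section Game.
Variables (V : finType) (e : rel V).

Definition dominating (D : {set V}) : Prop :=
  forall v, exists2 u, u \in D & u = v \/ e u v.

(* A history is the sequence of the vertices claimed so far, in order, without
   repetition; move number i (counted from 0) is made by turn first i. *)
Definition turn (first : player) (i : nat) : player :=
  if odd i then opponent first else first.

Definition dominator_set (first : player) (h : seq V) : {set V} :=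
  [set v in h | if turn first (index v h) is Dominator then true else false].

(* A strategy maps histories to moves; None, meaning no move, only serves when
   every vertex is claimed (and lets strategies exist on the empty graph). *)
Definition strategy := seq V -> option V.

Definition legal (sigma : strategy) : Prop :=
  forall h, uniq h -> size h < #|V| ->
    exists2 v, sigma h = Some v & v \notin h.

Definition complete_play (s : seq V) : Prop := uniq s /\ size s = #|V|.

Definition consistent (first : player) (sigma : strategy) (s : seq V) : Prop :=
  forall h v t, s = h ++ v :: t -> turn first (size h) = Dominator ->
    sigma h = Some v.

(* Quantifying over plays that go on until every vertex is claimed loses
   nothing: a play is won as soon as one of its prefixes is. *)
Definition dominator_winning_strategy (first : player) (sigma : strategy) :
    Prop :=
  legal sigma /\
  forall s, complete_play s -> consistent first sigma s ->
    exists i, dominating (dominator_set first (take i s)).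

Definition outcome_D : Prop :=
  forall first, exists sigma, dominator_winning_strategy first sigma.

End Game.

(* Main.v *)
(* If G has a perfect [1,2]-factor, Dominator keeps the vertices that she does
   not dominate yet covered by disjoint edges and cycles free of Staller: when
   Staller claims v, she claims a neighbour of v in its cycle, and the rest of
   the cycle, minus one more dominated vertex if needed, splits into edges.

   Otherwise Hall's theorem gives an independent set X and Y = N(X) with
   |Y| < |X|.  Take X minimal.  The bipartite graph between X and Y is connected,
   and some y in Y is a cut vertex of it: if not, an induction on the cut
   vertices in X reduces to the case where there is no cut vertex; there a graph
   without a subdivision of K_{2,3} has a Hamiltonian cycle, so |X| <= |Y|.
   Staller claims y.  By minimality at least two parts of the rest are still
   deficient; Dominator's answer meets at most one of them, and Staller goes on
   in another.

   That an outerplanar graph has no subdivision of K_{2,3} is proved by a parity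
   count.  Let P_1, P_2, P_3 be paths from a to b with interior vertices z_i, and
   let n_ij be the parity of the half turns of P_j - P_i when the pair
   (P_i, P_j) moves from (a, b) to (b, a) without collision; it does not depend
   on the motion, and n_ij + n_ji = 1.  If the z_i are on the boundary of the
   unbounded face, the winding number of P_j followed by the reverse of P_k
   around z_i vanishes, so that n_ij = n_ik.  But then
   n_12 = n_13 = 1 + n_31 = 1 + n_32 = n_23 = n_21 = 1 + n_12. *)

Require Import Defs.
From mathcomp Require Import all_boot all_order all_algebra.
From mathcomp Require Import boolp zify lra.

Set Implicit Arguments.
Unset Strict Implicit.
Unset Printing Implicit Defensive.

(* A subdivision of K_{2,3} with branch vertices a and b: the p i are the
   interiors of the three paths, up to repetitions inside a path. *)
Definition theta (V : finType) (e : rel V) (a b : V) (p : 'I_3 -> seq V) :=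
  [/\ a != b,
      forall i, [/\ p i != [::], path e a (rcons (p i) b), a \notin p i
                  & b \notin p i]
    & forall i j x, i != j -> x \in p i -> x \notin p j].

(** * Bipartite theta-free graphs without cut vertices on one side *)

Section Blocks.
Variables (V : finType) (h : rel V).
Hypotheses (h_sym : symmetric h).
Implicit Types (W C D X : {set V}) (c q : seq V).

(** Connectivity of the induced subgraph is put in terms of closed subsets, so that its failure
    directly yields a part [C] without edges to the rest of [W]. *)
Definition connected_in W := forall C, C \subset W -> C != set0 ->
  (forall u v, u \in C -> v \in W -> h u v -> v \in C) -> C = W.

Lemma connected_in_path W u v : connected_in W -> u \in W -> v \in W ->
  exists p, [/\ path h u p, last u p = v, uniq (u :: p)
              & {subset u :: p <= W}].
Proof.
move=> cW uW vW; pose h' := [rel x y | h x y && (y \in W)].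
have CW : [set x in W | connect h' u x] = W.
  apply: cW.
  - by apply/subsetP => x; rewrite inE => /andP[].
  - by apply/set0Pn; exists u; rewrite inE uW connect0.
  - move=> x y; rewrite !inE => /andP[xW ux] yW xy; rewrite yW /=.
    by apply: connect_trans ux (connect1 _); rewrite /= xy.
have := vW; rewrite -{1}CW inE => /andP[_ /connectP[p pp ->]].
case/shortenP: pp => p' pp' up' _; exists p'; split => //.
  by apply: sub_path pp' => x y /andP[].
move=> x; rewrite in_cons => /orP[/eqP -> //|].
elim: p' u pp' {up' uW CW} => //= y p' IH u /andP[/andP[_ yW] pp'].
by rewrite in_cons => /orP[/eqP -> //|]; apply: IH pp'.
Qed.

Lemma path_rcons_rev a b q :
  path h a (rcons q b) -> path h b (rcons (rev q) a).
Proof.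
move=> hp; have := rev_path h a (rcons q b).
rewrite last_rcons belast_rcons rev_cons => ->.
by apply: sub_path hp => x y; rewrite h_sym.
Qed.

(* The ear leaving c at c1 and returning at c2 forms a theta with the two arcs
   of c, unless one of these arcs is an edge, which the ear then replaces.  Here
   an edge is a cycle of length 2. *)
Lemma longer_cycle W c : connected_in W -> {in W, forall x, connected_in (W :\ x)} ->
  (forall a b p, ~ theta h a b p) ->
  cycle h c -> uniq c -> 1 < size c -> {subset c <= W} -> ~ {subset W <= c} ->
  exists c', [/\ cycle h c', uniq c', size c < size c' & {subset c' <= W}].
Proof.
move=> cW cWx noT cyc uc sc cW' Wc.
have [c1 [v [c1c vW vc c1v]]] :
    exists (c1 : V) v, [/\ c1 \in c, v \in W, v \notin c & h c1 v].
  apply: contrapT => no; apply: Wc => x;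
    rewrite -(_ : [set x in c] = W) ?inE //.
  apply: cW.
  - by apply/subsetP => y; rewrite inE; apply: cW'.
  - by case: c sc {cyc uc cW' no} => // y c _; apply/set0Pn; exists y;
      rewrite inE mem_head.
  - move=> u v; rewrite !inE => uc' vW uv; apply: contrapT => /negP vc.
    by apply: no; exists u, v.
have [d dc dc1] : exists2 d, d \in c & d != c1.
  case: c sc uc {cyc cW' Wc c1c vc} => [|x [|y c]] //= _ /andP[xy _].
  have [xc1|] := eqVneq x c1; last by exists x => //; rewrite mem_head.
  exists y; first by rewrite !inE eqxx orbT.
  by apply: contraNneq xy => ->; rewrite -xc1 mem_head.
have vc1 : v != c1 by apply: contraNneq vc => ->.
(* As [c1] is no cut vertex of [W], [v] reaches [c] again without passing through [c1]. The ear ends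
   at [c2], the first vertex of this path on [c], hence different from [c1]. *)
have [] := @connected_in_path _ v d (cWx _ (cW' _ c1c)).
- by rewrite !inE vc1.
- by rewrite !inE dc1 cW'.
move=> p [pp lp up sp].
have hasp : has (mem c) p.
  apply/hasP; exists d => //.
  have := mem_last v p; rewrite lp in_cons => /orP[/eqP dv|//].
  by rewrite dv (negbTE vc) in dc.
case: (split_find hasp) pp lp up sp => c2 p1 p2 c2c hasp1 pp lp up sp.
have {hasp1} p1c : forall x, x \in p1 -> x \notin c.
  by move=> x xp1; apply: contraNN hasp1 => xc; apply/hasP; exists x.
pose q := v :: p1.
have qc x : x \in q -> x \notin c by rewrite in_cons => /orP[/eqP ->|/p1c].
have qW x : x \in q -> x \in W.
  move=> xq; have : x \in W :\ c1; last by rewrite inE => /andP[].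
  apply: sp; move: xq; rewrite !in_cons mem_cat mem_rcons in_cons.
  by case/orP => ->; rewrite ?orbT.
have uq : uniq q.
  by move: up; rewrite -cat_cons cat_uniq -rcons_cons rcons_uniq => /andP[/andP[]].
have c21 : c2 != c1.
  have : c2 \in W :\ c1; last by rewrite !inE => /andP[].
  by apply: sp; rewrite !in_cons mem_cat mem_rcons mem_head !orbT.
have pq : path h c1 (rcons q c2).
  by move: pp; rewrite cat_path => /andP[pp _]; rewrite /= c1v.
have q0 : q != [::] by [].
clearbody q => {vc c1v vc1 vW pp lp up sp p1c}.
have [i c'' E] := rot_to c1c.
have memc : c =i c1 :: c'' by move=> x; rewrite -E mem_rot.
have sizec : size c = size (c1 :: c'') by rewrite -E size_rot.
move: cyc uc; rewrite -(rot_cycle i) -(rot_uniq i) E sizec => cyc uc.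
have {}qc x : x \in q -> x \notin c1 :: c'' by rewrite -memc; apply: qc.
have {}cW' : {subset c1 :: c'' <= W} by move=> x; rewrite -memc; apply: cW'.
have {}c2c : c2 \in c by []. rewrite memc in_cons (negbTE c21) /= in c2c.
case/splitPr: c2c cyc uc qc cW' {memc sizec E} => r1 r2.
rewrite [cycle _ _]/= rcons_cat rcons_cons -cat_rcons cat_path last_rcons.
move=> /andP[pr1 pr2] uc qc cW'.
have qC : all (predC (mem (c1 :: r1 ++ c2 :: r2))) q by apply/allP => x /qc.
have c1q : c1 \notin q.
  by apply/negP => /qc; rewrite mem_head.
have c2q : c2 \notin q.
  by apply/negP => /qc; rewrite in_cons mem_cat mem_head !orbT.
have r1q x : x \in r1 -> x \notin q.
  by move=> xr; apply/negP => /qc; rewrite in_cons mem_cat xr !orbT.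
have r2q x : x \in r2 -> x \notin q.
  by move=> xr; apply/negP => /qc; rewrite in_cons mem_cat in_cons xr !orbT.
move: (uc); rewrite /= mem_cat in_cons !negb_or cat_uniq /= negb_or.
move=> /andP[/and3P[c1r1 _ c1r2] /and3P[ur1 /andP[c2r1 r12] /andP[c2r2 ur2]]].
have [r1E|r10] := eqVneq r1 [::].
  exists (c1 :: q ++ c2 :: r2); split.
  - by rewrite /= rcons_cat rcons_cons -cat_rcons cat_path last_rcons pq.
  - rewrite /= mem_cat in_cons !negb_or c1q c1r2 eq_sym c21 /= cat_uniq uq /=.
    rewrite negb_or c2q c2r2 ur2 /= andbT; apply/hasPn => x; exact: r2q.
  - rewrite r1E /= !size_cat /= addnS !ltnS.
    by case: (q) q0 => //= ? ? _; rewrite addSn ltnS leq_addl.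
  - move=> x; rewrite in_cons mem_cat => /or3P[/eqP ->|/qW //|xr].
      by rewrite cW' // mem_head.
    by rewrite cW' // in_cons mem_cat xr !orbT.
have [r2E|r20] := eqVneq r2 [::].
  exists (c1 :: r1 ++ c2 :: rev q); split.
  - rewrite /= rcons_cat rcons_cons -cat_rcons cat_path last_rcons pr1 /=.
    exact: path_rcons_rev.
  - rewrite /= mem_cat in_cons mem_rev !negb_or c1r1 c1q eq_sym c21 /= cat_uniq ur1 /=.
    rewrite mem_rev rev_uniq negb_or c2r1 c2q uq /= andbT.
    by apply/hasPn => x; rewrite mem_rev; apply: contraTN; apply: r1q.
  - rewrite r2E /= !size_cat /= !addnS !ltnS size_rev addn0.
    by case: (q) q0 => //= ? ? _; rewrite addnS ltnS leq_addr.
  - move=> x; rewrite in_cons mem_cat in_cons mem_rev.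
    by case/or4P => [/eqP ->|xr|/eqP ->|/qW //]; rewrite cW' // in_cons mem_cat
      ?mem_head ?xr ?eqxx ?orbT.
case: (noT c1 c2 (fun i => nth [::] [:: r1; rev r2; q] i)); split.
- by rewrite eq_sym.
- case=> [[|[|[|//]]] ?] /=; split=> //.
  + by case: (r2) r20 => // ? ?; rewrite rev_cons; case: (rev _).
  + exact: path_rcons_rev.
  + by rewrite mem_rev.
  + by rewrite mem_rev.
- have d12 x : x \in r1 -> x \notin r2.
    by move=> xr; apply/negP => /(hasPn r12); rewrite /= xr.
  case=> [[|[|[|//]]] ?] [[|[|[|//]]] ?] x //= _; rewrite ?mem_rev.
  + exact: d12.
  + exact: r1q.
  + by apply: contraTN; apply: d12.
  + exact: r2q.
  + by apply: contraTN; apply: r1q.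
  + by apply: contraTN; apply: r2q.
Qed.

(** Start from an edge of [W], read as a cycle of length 2, and lengthen it while it misses a vertex
    of [W]; this stops because a cycle has at most [#|V|] vertices. *)
Lemma hamiltonian_cycle W : connected_in W ->
  {in W, forall x, connected_in (W :\ x)} -> (forall a b p, ~ theta h a b p) ->
  1 < #|W| -> exists c, [/\ cycle h c, uniq c & c =i W].
Proof.
move=> cW cWx noT /card_gt1P[u [w [uW wW uw]]].
have [c0 [cyc0 u0 s0 sub0]] : exists c0,
    [/\ cycle h c0, uniq c0, 1 < size c0 & {subset c0 <= W}].
  have [[|v p] [/= pp lp up sp]] := connected_in_path cW uW wW.
    by rewrite lp eqxx in uw.
  move: pp up => /andP[uv _] /andP[uvp _]; exists [:: u; v]; split=> //=.
  - by rewrite uv h_sym uv.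
  - by move: uvp; rewrite !inE negb_or andbT => /andP[].
  - by move=> x; rewrite !inE => /orP[] /eqP ->; rewrite sp ?inE ?eqxx ?orbT.
have [n hn] := ubnP (#|V| - size c0).
elim: n c0 hn cyc0 u0 s0 sub0 => // n IH c hn cyc uc sc sub.
have [Wc|Wc] := pselect {subset W <= c}.
  by exists c; split=> // x; apply/idP/idP => [/sub|/Wc].
have [c' [cyc' uc' lt' sub']] := longer_cycle cW cWx noT cyc uc sc sub Wc.
apply: (IH c') => //; last exact: ltn_trans lt'.
have := card_size c'; have := max_card (mem c'); rewrite (card_uniqP uc').
by move=> h1 _; rewrite ltnS in hn; apply: leq_trans hn;
  rewrite ltn_sub2l // (leq_trans lt').
Qed.

(** The successor on the cycle sends the vertices in [X] injectively to vertices outside [X]. *)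
Lemma balanced_cycle W X c : (forall u v, h u v -> (u \in X) != (v \in X)) ->
  cycle h c -> uniq c -> c =i W -> #|W :&: X| <= #|W :\: X|.
Proof.
move=> bip cyc uc cW.
rewrite -(card_imset (W :&: X) (can_inj (prev_next uc))).
apply/subset_leq_card/subsetP => y /imsetP[x /setIP[xW xX] ->].
rewrite inE -!cW mem_next cW xW andbT.
have := bip x (next c x) (next_cycle cyc _); rewrite cW xW xX => /(_ isT).
by case: (_ \in X).
Qed.

(** A closed part [D] of [x |: C] that contains [x] extends to the closed part [D :|: (W :\: C)] of
    [W], so it contains [C]; one that avoids [x] is closed in [W] already, which is impossible. *)
Lemma connected_in_side W C x : connected_in W -> x \in W -> C \subset W :\ x ->
  (forall u v, u \in C -> v \in W :\ x -> h u v -> v \in C) ->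
  connected_in (x |: C).
Proof.
move=> cW xW /subsetP CW clC D /subsetP DC D0 clD.
have CW' u : u \in C -> u \in W by move=> /CW /setD1P[].
have [xD|xD] := boolP (x \in D); last first.
  have DC' u : u \in D -> u \in C.
    by move=> uD; have := DC _ uD; rewrite !inE => /orP[/eqP ux|//];
      rewrite -ux uD in xD.
  suff DW : D = W by rewrite DW xW in xD.
  apply: cW => //; first by apply/subsetP => u /DC'/CW'.
  move=> u v uD vW uv; apply: (clD u) => //; rewrite !inE.
  have [//|vx /=] := eqVneq v x.
  by apply: (clC u) => //; [exact: DC'|rewrite !inE vx].
suff WE : D :|: (W :\: C) = W.
  apply/eqP; rewrite eqEsubset; apply/andP; split; first exact/subsetP.
  apply/subsetP => u; rewrite !inE => /orP[/eqP -> //|uC].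
  by have := CW' _ uC; rewrite -[in X in X -> _]WE !inE uC orbF.
apply: cW.
- apply/subsetP => u; rewrite !inE => /orP[/DC|/andP[] //].
  by case/setU1P => [-> //|/CW'].
- by apply/set0Pn; exists x; rewrite inE xD.
- move=> u v; rewrite !inE => /orP[uD|/andP[uC uW]] vW uv.
    have [vC|vC] := boolP (v \in C); last by rewrite vW orbT.
    by rewrite (clD u v) // !inE vC orbT.
  have [vC|vC] := boolP (v \in C); last by rewrite vW orbT.
  rewrite orbF; have [ux|ux] := eqVneq u x.
    by rewrite (clD x) // -?ux // !inE vC orbT.
  by rewrite (clC v u) ?inE ?ux // h_sym in uC.
Qed.

Lemma not_connected_in W : ~ connected_in W -> exists C,
  [/\ C \subset W, C != set0, C != W
    & forall u v, u \in C -> v \in W -> h u v -> v \in C].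
Proof.
move=> ncW; apply: contrapT => no; apply: ncW => C CW C0 clC.
by apply: contrapT => /eqP CnW; apply: no; exists C.
Qed.

(** Induction on [#|W|]. Without a cut vertex in [X] there is a Hamiltonian cycle. Otherwise a cut
    vertex [x] in [X] splits [W] into two smaller sides, both keeping [x]; adding their inequalities
    counts [x] twice on the left, so the sum is even stronger than needed. *)
Lemma cut_free_card W X : (forall u v, h u v -> (u \in X) != (v \in X)) ->
  (forall a b p, ~ theta h a b p) ->
  connected_in W -> 1 < #|W| ->
  {in W :\: X, forall y, connected_in (W :\ y)} -> #|W :&: X| <= #|W :\: X|.
Proof.
move=> bip noT; have [n] := ubnP #|W|; elim: n W => // n IH W ltn cW W1 cWy.
have [cWx|] := pselect {in W :&: X, forall x, connected_in (W :\ x)}.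
  have [|c [cyc uc cWE]] := hamiltonian_cycle cW _ noT W1.
    move=> x xW; have [xX|xX] := boolP (x \in X).
      by apply: cWx; rewrite inE xW.
    by apply: cWy; rewrite inE xX.
  exact: balanced_cycle uc cWE.
move=> /existsNP[x /not_implyP[/setIP[xW xX] /not_connected_in]].
move=> [C [CW C0 CnW clC]]; pose C' := W :\ x :\: C.
have C'W : C' \subset W :\ x by apply: subsetDl.
have clC' u v : u \in C' -> v \in W :\ x -> h u v -> v \in C'.
  rewrite /C' => /setDP[uW uC] vW uv; rewrite inE vW andbT.
  by apply: contraNN uC => vC; apply: (clC v) => //; rewrite h_sym.
have C'0 : C' != set0.
  rewrite setD_eq0; apply: contraNN CnW => WC.
  by rewrite eqEsubset CW.
have side D : D \subset W :\ x -> D != set0 -> D != W :\ x ->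
    (forall u v, u \in D -> v \in W :\ x -> h u v -> v \in D) ->
    #|(x |: D) :&: X| <= #|(x |: D) :\: X|.
  move=> DW D0 DnW clD.
  have xD : x \notin D.
    by apply/negP => /(subsetP DW); rewrite !inE eqxx.
  have D1 : 0 < #|D| by rewrite card_gt0.
  apply: IH.
  - rewrite ltnS in ltn; apply: leq_trans ltn.
    rewrite cardsU1 xD (cardsD1 x W) xW !add1n ltnS.
    by apply: proper_card; rewrite properEneq DnW.
  - exact: connected_in_side clD.
  - by rewrite cardsU1 xD add1n ltnS.
  - move=> y; rewrite !inE => /andP[yX /orP[/eqP yx|yD]].
      by rewrite yx xX in yX.
    have [yx yW] : y != x /\ y \in W.
      by have := subsetP DW _ yD; rewrite !inE => /andP[].
    have -> : (x |: D) :\ y = x |: (D :\ y).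
      apply/setP => u; rewrite !inE; have [->|//] := eqVneq u x.
      by rewrite eq_sym yx.
    apply: (@connected_in_side (W :\ y)).
    + by apply: cWy; rewrite inE yX.
    + by rewrite !inE eq_sym yx.
    + apply/subsetP => u; rewrite !inE => /andP[uy /(subsetP DW)].
      by rewrite !inE uy.
    + move=> u v; rewrite !inE => /andP[_ uD] /and3P[vx vy vW] uv.
      by rewrite vy (clD u) // !inE vx.
have C'nW : C' != W :\ x.
  have [u uC] := set0Pn _ C0; apply/eqP => /setP/(_ u).
  by rewrite inE uC (subsetP CW).
have := leq_add (side _ CW C0 CnW clC) (side _ C'W C'0 C'nW clC').
have CE u : (u \in C) = [&& u != x, u \in W & u \in C].
  by apply/idP/and3P => [uC|[]//]; have := subsetP CW _ uC;
    rewrite !inE => /andP[].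
rewrite -(cardsUI (_ :&: X)) -(cardsUI (_ :\: X)).
have -> : (x |: C) :&: X :|: (x |: C') :&: X = W :&: X.
  apply/setP => u; rewrite !inE CE; have [->|ux] := eqVneq u x;
    first by rewrite xW orbb.
  by case: (u \in C) (u \in W) (u \in X) => [] [] [].
have -> : (x |: C) :&: X :&: ((x |: C') :&: X) = [set x].
  apply/setP => u; rewrite !inE CE; have [->|ux] := eqVneq u x;
    first by rewrite xX.
  by case: (u \in C) (u \in W) (u \in X) => [] [] [].
have -> : ((x |: C) :\: X) :|: ((x |: C') :\: X) = W :\: X.
  apply/setP => u; rewrite !inE CE; have [->|ux] := eqVneq u x;
    first by rewrite xW orbb.
  by case: (u \in C) (u \in W) (u \in X) => [] [] [].
have -> : ((x |: C) :\: X) :&: ((x |: C') :\: X) = set0.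
  apply/setP => u; rewrite !inE CE; have [->|ux] := eqVneq u x;
    first by rewrite xX.
  by case: (u \in C) (u \in W) (u \in X) => [] [] [].
by rewrite cards1 cards0 addn0; apply: leq_trans; rewrite leq_addr.
Qed.

End Blocks.

(** * The domination game *)

Section Positions.
Variables (V : finType) (e : rel V).
Implicit Types (D S X Y : {set V}) (h s : seq V) (first : player).

(** The game by recursion on the number [n] of moves left, free of histories. Domination is tested
    only at the end, which suffices since Dominator's set only grows. *)
Fixpoint wins n D S (P : player) : Prop :=
  if n is n'.+1 then
    if P is Dominator then exists2 v, v \notin D :|: S & wins n' (v |: D) S Staller
    else forall v, v \notin D :|: S -> wins n' D (v |: S) Dominator
  else dominating e D.

Lemma dominatingS D D' : D \subset D' -> dominating e D -> dominating e D'.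
Proof. by move=> /subsetP DD' dD v; have [u /DD'] := dD v; exists u. Qed.

Lemma dominator_set_take first s i :
  dominator_set first (take i s) \subset dominator_set first s.
Proof.
apply/subsetP => v; rewrite !inE => /andP[vt].
rewrite (mem_take vt) -{2}(cat_take_drop i s) index_cat vt.
by [].
Qed.

Lemma dominator_set_rcons first h v : v \notin h ->
  dominator_set first (rcons h v) =
  if turn first (size h) is Dominator then v |: dominator_set first h
  else dominator_set first h.
Proof.
move=> vh; have E u : (u \in dominator_set first (rcons h v)) =
    if u == v then (if turn first (size h) is Dominator then true else false)
    else u \in dominator_set first h.
  rewrite !inE mem_rcons in_cons -cats1 index_cat.
  have [->|uv] := eqVneq u v; first by rewrite (negbTE vh) /= eqxx addn0.
  by case: (boolP (u \in h)).
apply/setP => u; rewrite E; case: (turn _ _); rewrite ?in_setU1.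
  by case: eqP.
by case: eqP => // ->; rewrite inE (negbTE vh).
Qed.

Lemma turn_opponent first i : turn (opponent first) i = opponent (turn first i).
Proof. by rewrite /turn; case: (odd i); case: first. Qed.

Lemma dominator_setU first h :
  dominator_set first h :|: dominator_set (opponent first) h = [set v in h].
Proof.
by apply/setP => v; rewrite !inE turn_opponent;
  case: (v \in h) (turn _ _) => [] [].
Qed.

Definition wins_after first h n := wins n (dominator_set first h)
  (dominator_set (opponent first) h) (turn first (size h)).

Lemma wins_after_dominator first h n : turn first (size h) = Dominator ->
  wins_after first h n.+1 <->
  exists2 v, v \notin h & wins_after first (rcons h v) n.
Proof.
move=> th; rewrite /wins_after th /=.
have step v : v \notin h -> wins_after first (rcons h v) n <->
    wins n (v |: dominator_set first h) (dominator_set (opponent first) h) Staller.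
  move=> vh; rewrite /wins_after !dominator_set_rcons // turn_opponent th /=.
  by rewrite size_rcons; move: th; rewrite /turn /=;
    case: (odd _) first => [] [].
have unclaimed v : (v \notin dominator_set first h
    :|: dominator_set (opponent first) h) = (v \notin h).
  by rewrite dominator_setU inE.
split=> -[v vh win]; exists v.
- by rewrite -unclaimed.
- by apply/step; rewrite -?unclaimed.
- by rewrite unclaimed.
- exact/(step v vh).
Qed.

Lemma wins_after_staller first h n : turn first (size h) = Staller ->
  wins_after first h n.+1 <->
  forall v, v \notin h -> wins_after first (rcons h v) n.
Proof.
move=> th; rewrite /wins_after th /=.
have step v : v \notin h -> wins_after first (rcons h v) n <->
    wins n (dominator_set first h) (v |: dominator_set (opponent first) h) Dominator.
  move=> vh; rewrite /wins_after !dominator_set_rcons // turn_opponent th /=.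
  by rewrite size_rcons; move: th; rewrite /turn /=;
    case: (odd _) first => [] [].
split=> H v; have := H v; rewrite dominator_setU inE => {}H vh.
  by apply/step => //; apply: H.
by apply/(step v vh); apply: H.
Qed.

Lemma wins_strategy first : wins #|V| set0 set0 first ->
  exists sigma, dominator_winning_strategy e first sigma.
Proof.
move=> win; pose good h v := v \notin h /\
  wins_after first (rcons h v) (#|V| - (size h).+1).
(* Dominator moves to a winning position when there is one. Any unclaimed vertex serves otherwise:
   this keeps the strategy legal and does not occur at her turns in a consistent play. *)
exists (fun h => if pselect (exists v, good h v) is left ex
  then Some (projT1 (cid ex)) else [pick v | v \notin h]).
split.
  move=> h uh hV; case: pselect => [ex|_].
    by exists (projT1 (cid ex)) => //; have [] := projT2 (cid ex).
  case: pickP => [v vh|no]; first by exists v.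
  move: hV; rewrite ltnNge -(card_uniqP uh) => /negP[].
  by apply: subset_leq_card; apply/subsetP => v _; have /negbFE := no v.
move=> s [us ss] cons; exists (size s); rewrite take_size.
suff H h t : s = h ++ t -> wins_after first h (#|V| - size h).
  by have := H s [::]; rewrite cats0 ss subnn; apply.
elim/last_ind: h t => [|h v IH] t E.
  rewrite /wins_after subn0 /turn /=.
  by have -> f : dominator_set f [::] = set0 by apply/setP => v; rewrite !inE.
have {E}Es : s = h ++ v :: t by rewrite -cat_rcons.
have vh : v \notin h by move: us;
  rewrite Es cat_uniq /= negb_or => /and3P[_ /andP[]].
have := IH _ Es; rewrite size_rcons.
have lt : size h < #|V| by rewrite -ss Es size_cat /= addnS ltnS leq_addr.
rewrite -{1}(subnSK lt).
case th : (turn first (size h)).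
- move=> /(wins_after_dominator _ th)[w wh win_w].
  have := cons _ _ _ Es th; case: pselect => [ex|[]]; last by exists w.
  by case=> <-; have [] := projT2 (cid ex).
- by move=> /(wins_after_staller _ th); apply.
Qed.

Lemma strategy_wins first sigma : dominator_winning_strategy e first sigma ->
  wins #|V| set0 set0 first.
Proof.
move=> [leg win].
suff H n h : uniq h -> n + size h = #|V| -> consistent first sigma h ->
    wins_after first h n.
  have := H #|V| [::] isT; rewrite addn0 /wins_after /turn /=.
  have E f : dominator_set f [::] = set0 :> {set V}.
    by apply/setP => v; rewrite !inE.
  by rewrite !E; apply=> // -[|? ?] ? ?.
elim: n h => [|n IH] h uh nh ch.
  (* The strategy guarantees domination after some prefix of the play; it persists to the end. *)
  have [i] := win h (conj uh nh) ch.
  exact/dominatingS/dominator_set_take.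
case th : (turn first (size h)).
- apply/(wins_after_dominator _ th).
  have [|v sv vh] := leg h uh; first by rewrite -nh addSn ltnS leq_addl.
  exists v => //; apply: IH; rewrite ?rcons_uniq ?vh ?size_rcons //.
    by rewrite addnS.
  move=> h' w t; case/lastP: t => [|t z].
    rewrite cats1 => /rcons_inj[<- <-] _; exact: sv.
  by rewrite -rcons_cons -rcons_cat => /rcons_inj[/ch].
- apply/(wins_after_staller _ th) => v vh.
  apply: IH; rewrite ?rcons_uniq ?vh ?size_rcons //.
    by rewrite addnS.
  move=> h' w t; case/lastP: t => [|t z].
    by rewrite cats1 => /rcons_inj[<- <-]; rewrite th.
  by rewrite -rcons_cons -rcons_cat => /rcons_inj[/ch].
Qed.

Lemma outcome_wins : outcome_D e <-> forall first, wins #|V| set0 set0 first.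
Proof.
split=> H first; last exact: wins_strategy.
by have [sigma] := H first; apply: strategy_wins.
Qed.

Lemma unclaimedD D S v : v \notin D :|: S ->
  #|~: (D :|: S)| = #|~: ((v |: D) :|: S)|.+1.
Proof.
move=> vDS; rewrite (cardsD1 v) inE vDS add1n; congr _.+1; apply: eq_card => u.
by rewrite !inE; case: (u == v) (u \in D) (u \in S) => [] [] [].
Qed.

Lemma unclaimedS D S v : v \notin D :|: S ->
  #|~: (D :|: S)| = #|~: (D :|: (v |: S))|.+1.
Proof.
by rewrite setUC [D :|: (v |: S)]setUC; apply: unclaimedD.
Qed.

Lemma claim_staller_disjoint D S v :
  v \notin D :|: S -> D :&: S = set0 -> D :&: (v |: S) = set0.
Proof.
move=> vDS DS; rewrite setIUr DS setU0; apply/eqP.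
rewrite setIC setI_eq0 disjoints1.
by apply: contraNN vDS => vD; rewrite inE vD.
Qed.

Lemma claim_dominator_disjoint D S v :
  v \notin D :|: S -> D :&: S = set0 -> (v |: D) :&: S = set0.
Proof.
rewrite setUC setIC => vSD SD; rewrite setIC.
exact: claim_staller_disjoint.
Qed.

(** Play on to the end: Dominator's final set dominates and still avoids [S]. Hence [wins] fails as
    soon as [S] contains a closed neighbourhood. *)
Lemma wins_dominating n D S P : #|~: (D :|: S)| = n -> D :&: S = set0 ->
  wins n D S P -> exists2 D', D' :&: S = set0 & dominating e D'.
Proof.
elim: n D S P => [|n IH] D S P nE DS /=; first by exists D.
case: P => [[v vDS win]|win].
  have nE' := succn_inj (etrans (esym (unclaimedD vDS)) nE).
  exact: IH nE' (claim_dominator_disjoint vDS DS) win.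
have [v vU] : exists v, v \in ~: (D :|: S) by apply/set0Pn;
  rewrite -card_gt0 nE.
have vDS : v \notin D :|: S by rewrite -in_setC.
have nE' := succn_inj (etrans (esym (unclaimedS vDS)) nE).
have [D' D'S dom] := IH _ _ _ nE' (claim_staller_disjoint vDS DS) (win v vDS).
exists D' => //; apply/setP => u; move/setP/(_ u): D'S; rewrite !inE.
by case: (u \in D') (u \in S) => [] [] //; rewrite orbT.
Qed.

End Positions.

(** * Splitting a deficient set at a cut vertex *)

Section StallerSide.
Variables (V : finType) (e : rel V).
Hypotheses (e_sym : symmetric e) (no_theta : forall a b p, ~ theta e a b p).
Implicit Types (D S X Y T Z : {set V}).

(** A violation of Hall's condition relative to the vertices [S] that Staller already holds. When
    [Y] is empty, one unclaimed vertex of [X] completes a closed neighbourhood. *)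
Definition surrounded S X Y :=
  (forall x v, x \in X -> e x v -> v \in Y :|: S) /\ #|Y| < #|X|.

(* A minimal X' in X having fewer neighbours in Y than elements is connected
   together with them, hence by cut_free_card some y in Y disconnects it; by
   minimality, each side has exactly one more element in X' than in Y. *)
Lemma surrounded_split S X Y : [disjoint X & Y] -> surrounded S X Y ->
  (exists2 x, x \in X & forall v, e x v -> v \in S) \/
  exists y X1 Y1 X2 Y2,
    [/\ y \in Y, X1 :|: X2 \subset X, Y1 :|: Y2 \subset Y :\ y,
        [disjoint X1 :|: Y1 & X2 :|: Y2] &
        surrounded (y |: S) X1 Y1 /\ surrounded (y |: S) X2 Y2].
Proof.
move=> /disjoint_setI0 XY [XYS YX].
pose N X' := [set y in Y | [exists x in X', e x y]].
have XN x v X' : X' \subset X -> x \in X' -> e x v -> v \in N X' :|: S.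
  move=> /subsetP X'X xX' xv; have := XYS _ _ (X'X _ xX') xv.
  rewrite !inE => /orP[vY|->]; last by rewrite orbT.
  by rewrite vY /=; apply/orP; left; apply/existsP; exists x; rewrite xX'.
pose P X' := (X' \subset X) && (#|N X'| < #|X'|).
have PX : P X.
  rewrite /P subxx; apply: leq_ltn_trans YX; apply: subset_leq_card.
  by apply/subsetP => y; rewrite inE => /andP[].
have [X' /minsetP[/andP[X'X ltX'] minX'] _] := minset_exists PX.
have {}minX' T : T \subset X' -> T != X' -> #|T| <= #|N T|.
  move=> TX' TneX'; rewrite leqNgt; apply: contraNN TneX' => lt.
  apply/eqP/minX' => //; rewrite /P lt andbT; exact: subset_trans X'X.
have [Y'0|Y'0] := eqVneq (N X') set0.
  left; have [x xX'] : exists x, x \in X'.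
    by apply/set0Pn; rewrite -card_gt0 (leq_trans _ ltX').
  exists x; first exact: subsetP X'X _ xX'.
  by move=> v /(XN _ _ _ X'X xX'); rewrite Y'0 set0U.
right; pose Y' := N X'; pose W := X' :|: Y'.
(* Keeping only the edges with exactly one end in [X'] makes the graph bipartite; a theta in this
   subgraph is a theta of [e]. *)
pose h u v := e u v && ((u \in X') != (v \in X')).
have h_sym : symmetric h by move=> u v; rewrite /h e_sym eq_sym.
have noh a b p : ~ theta h a b p.
  move=> [ab hp disj]; apply: (@no_theta a b p); split=> // i.
  by have [? pp ? ?] := hp i; split=> //; apply: sub_path pp => u v /andP[].
have Y'Y : Y' \subset Y by apply/subsetP => y; rewrite inE => /andP[].
have X'Y' u : u \in X' -> u \in Y = false.
  move=> uX'; apply/negP => uY; move/setP/(_ u): XY.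
  by rewrite !inE uY (subsetP X'X).
have X'Y'' u : u \in X' -> u \in Y' = false.
  by move=> /X'Y'; apply: contraFF => /(subsetP Y'Y).
have Y'X' u : u \in Y' -> u \in X' = false.
  by move=> uY'; apply/negP => /X'Y''; rewrite uY'.
(* [Z] is the set of removed vertices: empty for the proof that [W] is connected, then [[set y]] for
   the cut vertex [y]. [T] is a union of components of what is left. *)
have piece Z T : Z \subset Y' -> T \subset W :\: Z -> T != set0 -> T != W :\: Z ->
    (forall u v, u \in T -> v \in W :\: Z -> h u v -> v \in T) ->
    X' :&: T != set0 /\ N (X' :&: T) \subset (Y' :&: T) :|: Z.
  move=> ZY' /subsetP TW /set0Pn[t tT] TneW clT; split.
    apply/set0Pn; have [tX'|tX'] := boolP (t \in X'); first by exists t;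
      rewrite inE tX'.
    have tY' : t \in Y'.
      by have := TW _ tT; rewrite 2!inE (negbTE tX') => /andP[].
    move: (tY'); rewrite inE => /andP[_ /existsP[x /andP[xX' xt]]].
    exists x; rewrite inE xX' (clT t) //.
      rewrite 2!inE xX' andbT; apply/negP => /(subsetP ZY').
      by rewrite X'Y''.
    by rewrite /h e_sym xt xX' (negbTE tX').
  apply/subsetP => y;
    rewrite inE => /andP[yY /existsP[x /andP[/setIP[xX' xT] xy]]].
  have yY' : y \in Y' by rewrite inE yY; apply/existsP; exists x; rewrite xX'.
  rewrite 2!inE yY'; case: (boolP (y \in Z)) => [_|yZ]; first by rewrite orbT.
  have -> // : y \in T.
  apply: (clT x) => //; last by rewrite /h xy xX' Y'X'.
  by rewrite inE yZ inE yY' orbT.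
have pieces Z T : Z \subset Y' -> T \subset W :\: Z -> T != set0 -> T != W :\: Z ->
    (forall u v, u \in T -> v \in W :\: Z -> h u v -> v \in T) ->
    let T' := W :\: Z :\: T in
    [/\ N (X' :&: T) \subset (Y' :&: T) :|: Z,
        N (X' :&: T') \subset (Y' :&: T') :|: Z,
        #|X' :&: T| <= #|Y' :&: T| + #|Z|, #|X' :&: T'| <= #|Y' :&: T'| + #|Z|
      & #|Y' :&: T| + #|Y' :&: T'| + #|Z| < #|X' :&: T| + #|X' :&: T'|].
  move=> ZY' TW T0 TneW clT T'.
  have T'W : T' \subset W :\: Z by apply: subsetDl.
  have T'0 : T' != set0.
    by rewrite setD_eq0; apply: contraNN TneW => WT; rewrite eqEsubset TW.
  have T'neW : T' != W :\: Z.
    have [t tT] := set0Pn _ T0; apply/eqP => /setP/(_ t).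
    by rewrite [t \in T']inE tT (subsetP TW).
  have clT' u v : u \in T' -> v \in W :\: Z -> h u v -> v \in T'.
    move=> /setDP[uW uT] vW uv; rewrite inE vW andbT.
    by apply: contraNN uT => vT; apply: (clT v); rewrite // h_sym.
  have [XT0 NT] := piece _ _ ZY' TW T0 TneW clT.
  have [XT'0 NT'] := piece _ _ ZY' T'W T'0 T'neW clT'.
  have card_le U : X' :&: U != X' -> N (X' :&: U) \subset (Y' :&: U) :|: Z ->
      #|X' :&: U| <= #|Y' :&: U| + #|Z|.
    move=> ne /subset_leq_card le; apply: leq_trans (minX' _ _ ne) _.
      exact: subsetIl.
    by apply: leq_trans le _; rewrite -cardsUI leq_addr.
  have disj u : u \in X' :&: T -> u \in X' :&: T' -> False.
    by rewrite !inE => /andP[_ ->]; rewrite andbF.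
  have I0 U : (U :&: T) :&: (U :&: T') = set0.
    by apply/setP => u; rewrite !inE; case: (u \in T); rewrite ?andbF.
  have Xsplit : #|X'| = #|X' :&: T| + #|X' :&: T'|.
    rewrite -cardsUI I0 cards0 addn0; congr #|pred_of_set _|.
    apply/setP => u; rewrite /T' !(in_setU, in_setD, in_setI).
    case uX' : (u \in X') => //=; have -> : u \in Z = false.
      by apply/negP => /(subsetP ZY'); rewrite X'Y''.
    by case: (u \in T).
  have Ysplit : #|Y'| = #|Y' :&: T| + #|Y' :&: T'| + #|Z|.
    rewrite -(cardsID Z Y') addnC (setIidPr ZY') -(cardsUI (Y' :&: T)) I0 cards0 addn0.
    congr (#|pred_of_set _| + _); apply/setP => u; have := subsetP TW u.
    rewrite /T' !(in_setU, in_setD, in_setI).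
    case uY' : (u \in Y'); last by rewrite andbF.
    by rewrite /= orbT; case: (u \in T) => [/(_ isT)/andP[->]|_] //=.
  split=> //.
  - apply: card_le NT; apply: contraNN XT'0 => /eqP XE.
    apply/eqP/setP => u; rewrite [RHS]inE; apply/negP => /[dup] uT'.
    by move=> /setIP[uX' _]; apply: disj uT'; rewrite XE.
  - apply: card_le NT'; apply: contraNN XT0 => /eqP XE.
    apply/eqP/setP => u; rewrite [RHS]inE; apply/negP => /[dup] uT.
    by move=> /setIP[uX' _]; apply: (disj u) => //; rewrite XE.
  - by rewrite -Ysplit -Xsplit.
have cW : connected_in h W.
  apply: contrapT => /not_connected_in[T [TW T0 TneW clT]].
  have [|||||_ _ le1 le2 lt] := pieces set0 T; rewrite ?sub0set ?setD0 //.
  move: le1 le2 lt; rewrite cards0 !addn0 => le1 le2.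
  by rewrite ltnNge leq_add.
have WX : W :&: X' = X'.
  apply/setP => u; rewrite !inE; case: (u \in X') => //=; exact: andbF.
have WY : W :\: X' = Y'.
  apply/setP => u; rewrite in_setD in_setU; case uX' : (u \in X') => //=.
  by apply/esym; apply: X'Y''.
have [y yY' ncy] : exists2 y, y \in Y' & ~ connected_in h (W :\ y).
  apply: contrapT => no.
  have := @cut_free_card _ h h_sym W X' _ noh cW.
  rewrite WX WY => H; suff : #|X'| <= #|Y'| by rewrite leqNgt ltX'.
  apply: H.
  - by move=> u v /andP[].
  - have X'0 : 0 < #|X'| by apply: leq_ltn_trans ltX'.
    have Y'c : 0 < #|Y'| by rewrite card_gt0.
    by rewrite -(cardsID X') WX WY; exact: leq_add X'0 Y'c.
  - move=> y yY'; apply: contrapT => ncy; apply: no; by exists y.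
have [T [TW T0 TneW clT]] := not_connected_in ncy.
have yYs : [set y] \subset Y' by rewrite sub1set.
have [N1 N2 le1 le2 lt] := pieces _ _ yYs TW T0 TneW clT.
rewrite cards1 in le1 le2 lt.
exists y, (X' :&: T), (Y' :&: T), (X' :&: (W :\ y :\: T)), (Y' :&: (W :\ y :\: T)).
have yT : y \notin T by apply/negP => /(subsetP TW); rewrite !inE eqxx.
split.
- exact: subsetP Y'Y _ yY'.
- by rewrite -setIUr (subset_trans (subsetIl _ _)).
- rewrite -setIUr; apply/subsetP => u /setIP[uY' uTT].
  rewrite in_setD1 (subsetP Y'Y) // andbT; apply: contraNneq yT => uy.
  by move: uTT; rewrite uy !(in_setU, in_setD, in_set1) eqxx /= andbF orbF.
- rewrite -setI_eq0 -!setIUl; apply/eqP/setP => u; rewrite !inE.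
  by case: (u \in T); rewrite /= ?andbF.
- have side U : N (X' :&: U) \subset Y' :&: U :|: [set y] -> #|Y' :&: U| < #|X' :&: U| ->
    surrounded (y |: S) (X' :&: U) (Y' :&: U).
    move=> NU ltU; split=> // x v xU xv.
    have := XN _ _ _ (subset_trans (subsetIl X' U) X'X) xU xv.
    rewrite inE => /orP[/(subsetP NU)|vS].
      by rewrite !inE; case/orP => ->; rewrite ?orbT.
    by rewrite !inE vS !orbT.
  (* Each part has an excess of at most one and the two excesses add up to at least two, so both are
     positive. *)
  split; apply: side => //; move: le1 le2 lt; clear;
    move: #|_| #|_| #|_| #|_| => *; lia.
Qed.
End StallerSide.

(** * The strategies of Staller and of Dominator *)

Section Strategies.
Variables (V : finType) (e : rel V).
Hypothesis e_sym : symmetric e.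
Implicit Types (D S X Y : {set V}) (c s : seq V) (L : seq (seq V)).

(** Strong induction on the number of unclaimed vertices, since a round takes two moves. Staller
    either completes a closed neighbourhood or claims [y]; Dominator's reply [w] misses one of the
    two disjoint parts, where the induction hypothesis applies. *)
Lemma surrounded_staller_wins n D S X Y : (forall a b p, ~ theta e a b p) ->
  #|~: (D :|: S)| = n -> D :&: S = set0 -> [disjoint X :|: Y & D :|: S] ->
  [disjoint X & Y] -> surrounded e S X Y -> ~ wins e n D S Staller.
Proof.
move=> noth; have [m] := ubnP n; elim: m n D S X Y => // m IH n D S X Y nm.
move=> nE DS XYDS XY sXY win.
have free u : u \in X :|: Y -> u \notin D :|: S.
  by move=> uXY; rewrite (disjointFr XYDS uXY).
have n0 u : u \in X :|: Y -> exists n', n = n'.+1.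
  move=> /free uf; move: nE; rewrite (unclaimedS uf); case: (n) => // n' _.
  by exists n'.
case: (surrounded_split e_sym noth XY sXY) => [[x xX xS]|].
  have xXY : x \in X :|: Y by rewrite inE xX.
  have [n' n'E] := n0 _ xXY; rewrite n'E in nE win nm.
  have xf := free _ xXY; have win' := win x xf.
  have nE' := succn_inj (etrans (esym (unclaimedS xf)) nE).
  have [D' D'S dom] := wins_dominating nE' (claim_staller_disjoint xf DS) win'.
  have [u uD' [ux|xu]] := dom x; move/setP/(_ u): D'S; rewrite !inE uD' /=.
    by rewrite ux eqxx.
  by rewrite xS ?orbT // e_sym.
move=> [y [X1 [Y1 [X2 [Y2 [yY XX YY dXY [s1 s2]]]]]]].
have yXY : y \in X :|: Y by rewrite inE yY orbT.
have [n' n'E] := n0 _ yXY; rewrite n'E in nE win nm.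
have yf := free _ yXY; have win' := win y yf.
have nE' := succn_inj (etrans (esym (unclaimedS yf)) nE).
have X1X : X1 \subset X := subset_trans (subsetUl _ _) XX.
have X2X : X2 \subset X := subset_trans (subsetUr _ _) XX.
have Y1Y : Y1 \subset Y :\ y := subset_trans (subsetUl _ _) YY.
have Y2Y : Y2 \subset Y :\ y := subset_trans (subsetUr _ _) YY.
have free' X' Y' u : X' \subset X -> Y' \subset Y :\ y -> u \in X' :|: Y' ->
    u \notin D :|: (y |: S).
  move=> X'X Y'Y uXY; have [uXY' uy] : u \in X :|: Y /\ u != y.
    move: uXY; rewrite !inE => /orP[/(subsetP X'X) uX|/(subsetP Y'Y)].
      rewrite uX; split=> //; apply: contraTneq uX => ->.
      by rewrite (disjointFl XY yY).
    by rewrite !inE => /andP[-> ->]; rewrite orbT.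
  by have := free u uXY'; rewrite !inE (negbTE uy).
have [x1 x1X] : exists x, x \in X1.
  by have [_ lt] := s1; apply/set0Pn; rewrite -card_gt0;
    apply: leq_ltn_trans lt.
have x1f : x1 \notin D :|: (y |: S) by apply: (free' X1 Y1); rewrite // inE x1X.
case: n' {n'E win} nE' win' nE nm => [|k] nE' win' nE nm.
  by move: nE'; rewrite (unclaimedS x1f).
have [w wf win''] := win'.
have nE'' := succn_inj (etrans (esym (unclaimedD wf)) nE').
have DS' := claim_dominator_disjoint wf (claim_staller_disjoint yf DS).
have fin X' Y' : X' \subset X -> Y' \subset Y :\ y -> w \notin X' :|: Y' ->
    surrounded e (y |: S) X' Y' -> False.
  move=> X'X Y'Y wXY sur; apply: (IH _ _ _ X' Y' _ nE'' DS' _ _ sur win'').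
  - by rewrite ltnS in nm; apply: ltnW.
  - rewrite -setI_eq0; apply/eqP/setP => u; rewrite inE [RHS]inE.
    apply/negP => /andP[uXY]; rewrite -setUA in_setU1.
    have [uw|uw] := eqVneq u w; first by rewrite -uw uXY in wXY.
    by rewrite (negbTE (free' _ _ _ X'X Y'Y uXY)).
  - apply: disjointWl X'X _;
      apply: disjointWr (subset_trans Y'Y (subsetDl _ _)) _.
    exact: XY.
have [w1|w1] := boolP (w \in X1 :|: Y1); last exact: (fin X1 Y1).
apply: (fin X2 Y2) => //; apply/negP => w2.
by rewrite (disjointFr dXY w1) in w2.
Qed.

(* The invariant of Dominator; a cycle of length 2 stands for an edge. *)
Definition cycle_cover D S L :=
  [/\ uniq (flatten L), all (fun c => cycle e c && (1 < size c)) L,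
      {in flatten L, forall v, v \notin S}
    & forall v, v \notin flatten L -> exists2 u, u \in D & u = v \/ e u v].

Fixpoint pairs s : seq (seq V) :=
  if s is x :: y :: s' then [:: x; y] :: pairs s' else [::].

Lemma pairsP s : sorted e s -> ~~ odd (size s) ->
  flatten (pairs s) = s /\ all (fun c => cycle e c && (1 < size c)) (pairs s).
Proof.
have [n] := ubnP (size s); elim: n s => // n IH [|x [|y s]] //= lt /andP[xy p].
rewrite negbK => ev; have [] := IH s _ (path_sorted p) ev.
  by rewrite ltnS in lt; apply: leq_trans lt; rewrite leqnSn.
by move=> -> ->; rewrite xy e_sym xy.
Qed.

Lemma cycle_cover_reply D S L v : cycle_cover D S L -> v \in flatten L ->
  exists w L', [/\ w \in flatten L, w != v & cycle_cover (w |: D) (v |: S) L'].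
Proof.
move=> [uL cL LS LD] /flattenP[c cinL vc].
have [i L0 EL] := rot_to cinL; have [j c' Ec] := rot_to vc.
have /andP[cyc sz] := allP cL _ cinL.
have pF : perm_eq (flatten ((v :: c') :: L0)) (flatten L).
  have /perm_flatten : perm_eq (rot i L) L by rewrite perm_rot.
  by apply: perm_trans; rewrite EL -Ec /= perm_cat2r perm_rot.
move: uL; rewrite -(perm_uniq pF).
have {pF} memL := perm_mem pF.
have {}cL : all (fun c => cycle e c && (1 < size c)) L0.
  by apply/allP => d dL0; apply: (allP cL);
    rewrite -(mem_rot i) EL in_cons dL0 orbT.
move: cyc sz; rewrite -(rot_cycle j) -(size_rot j) Ec.
case: c' {Ec} memL => [|w t] memL //= /andP[vw pt] _.
rewrite inE mem_cat !negb_or => /and3P[/and3P[vw' vt vL0] wtL0 utL0].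
have {wtL0} wt : w \notin t ++ flatten L0 by [].
(* The cycle reads [v], [w], [t], and [w] is the reply. If [t] has odd length its first vertex is
   dropped, being dominated by [w]; the remaining path has even length and splits into edges. *)
pose r := if odd (size t) then behead t else t.
have evr : ~~ odd (size r).
  by rewrite /r; case E : (odd (size t)); move: E; case: (t) => //= ? ? ->.
have sr : sorted e r.
  move: pt; rewrite rcons_path => /andP[pt _].
  rewrite /r; case: odd; case: (t) pt => //= x t' /andP[_ p] //.
  exact: path_sorted p.
have rt : {subset r <= t} by rewrite /r; case: odd => // x; exact: mem_behead.
have ur : uniq (r ++ flatten L0).
  by move: utL0; rewrite /r; case: odd => //; case: (t) => //= ? ? /andP[].
have tr u : u \in t -> u \in r \/ e w u.
  rewrite /r; case: odd; last by left.
  move: pt; case: (t) => //= x t' /andP[wx _]; rewrite in_cons.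
  by case/orP => [/eqP ->|]; [right|left].
have [fr cr] := pairsP sr evr.
have fL' : flatten (pairs r ++ L0) = r ++ flatten L0 by rewrite flatten_cat fr.
exists w, (pairs r ++ L0); split.
- by rewrite -memL /= !inE eqxx orbT.
- by rewrite eq_sym.
split; first by rewrite fL'.
- by rewrite all_cat cr.
- move=> u; rewrite fL' !inE negb_or => uL'; apply/andP; split.
    move: uL'; rewrite mem_cat; apply: contraTneq => ->.
    by rewrite negb_or vL0 andbT; apply: contraNN vt => /rt.
  apply: LS; rewrite -memL /= !inE mem_cat.
  by move: uL'; rewrite mem_cat => /orP[/rt|] ->; rewrite !orbT.
- move=> u; rewrite fL' mem_cat negb_or => /andP[ur' uL0].
  have [uL|uL] := boolP (u \in flatten L); last first.
    by have [u' u'D h] := LD u uL; exists u'; rewrite // inE u'D orbT.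
  exists w; first by rewrite setU11.
  move: uL; rewrite -memL /= !inE mem_cat (negbTE uL0) orbF.
  case/or3P => [/eqP ->|/eqP ->|/tr[]]; [by right;
    rewrite e_sym|by left| |by right].
  by rewrite (negbTE ur').
Qed.

(** A move of Dominator never damages the cover, so she needs to react only when Staller enters it.
    At the end a covered vertex, not being Staller's, is Dominator's own. *)
Lemma cycle_cover_wins n D S L P : #|~: (D :|: S)| = n -> D :&: S = set0 ->
  cycle_cover D S L -> wins e n D S P.
Proof.
have [m] := ubnP n; elim: m n D S L P => // m IH n D S L P nm nE DS cov.
have [uL cL LS LD] := cov.
have coverD w : cycle_cover (w |: D) S L.
  split=> // u /LD[u' u'D h]; exists u' => //.
  by rewrite inE u'D orbT.
case: n nE nm => [|n] nE nm.
  move=> v; have [vL|/LD//] := boolP (v \in flatten L).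
  exists v; last by left.
  have : v \notin ~: (D :|: S) by rewrite (cards0_eq nE) inE.
  by rewrite !inE negbK (negbTE (LS _ vL)) orbF.
case: P => /=.
  have [v vU] : exists v, v \in ~: (D :|: S) by apply/set0Pn;
    rewrite -card_gt0 nE.
  have vf : v \notin D :|: S by rewrite -in_setC.
  exists v => //; apply: (IH _ _ _ L) => //.
    exact: succn_inj (etrans (esym (unclaimedD vf)) nE).
  exact: claim_dominator_disjoint.
move=> v vf; have nE' := succn_inj (etrans (esym (unclaimedS vf)) nE).
have DS' := claim_staller_disjoint vf DS.
have [vL|vL] := boolP (v \in flatten L); last first.
  apply: (IH _ _ _ L) => //; split=> // u uF; rewrite !inE negb_or LS // andbT.
  by apply: contraNneq vL => <-.
have [w [L' [wL wv cov']]] := cycle_cover_reply cov vL.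
(* If the reply is already hers, the new cover holds as it stands and she may move anywhere. *)
have [wD|wD] := boolP (w \in D).
  by apply: (IH _ _ _ L') => //; move: cov'; rewrite (setUidPr _) ?sub1set.
have wf : w \notin D :|: (v |: S) by rewrite !inE !negb_or wD wv LS.
case: n nE nE' nm => [|n] nE nE' nm; first by move: nE';
  rewrite (unclaimedD wf).
exists w => //; apply: (IH _ _ _ L') => //; first by rewrite ltnS in nm;
  apply: ltnW.
  exact: succn_inj (etrans (esym (unclaimedD wf)) nE').
exact: claim_dominator_disjoint.
Qed.

End Strategies.

(** * Hall's theorem and perfect [1,2]-factors *)

Section Hall.
Variables (T U : finType).
Implicit Types (A B X : {set T}) (M : {set U}) (r : T -> {set U}).

Definition neighbourhood r X := \bigcup_(x in X) r x.

Lemma neighbourhoodD r M X :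
  neighbourhood (fun x => r x :\: M) X = neighbourhood r X :\: M.
Proof.
apply/setP => u; rewrite inE;
  apply/bigcupP/andP => [[x xX]|[uM /bigcupP[x xX ur]]].
  by rewrite inE => /andP[uM ur]; split=> //; apply/bigcupP; exists x.
by exists x; rewrite // inE uM.
Qed.

(* The unused f0 only ensures that functions from T to U exist. *)
Theorem hall_marriage (f0 : T -> U) r A :
  (forall X, X \subset A -> #|X| <= #|neighbourhood r X|) ->
  exists f : T -> U, {in A, forall x, f x \in r x} /\ {in A &, injective f}.
Proof.
have [n] := ubnP #|A|; elim: n r A => // n IH r A ltn hall.
have [->|/set0Pn[a aA]] := eqVneq A set0.
  by exists f0; split=> x; rewrite inE.
(* Both cases of the proof produce a part [B] matched into [M] such that Hall's condition survives
   on the rest without [M]: a proper tight subset with its neighbourhood or, if there is none, one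
   vertex with one of its neighbours. *)
have [B [M [f [BA B0 [fr finj] fM hallD]]]] : exists B M f,
    [/\ B \subset A, B != set0, {in B, forall x, f x \in r x} /\ {in B &, injective f},
     {in B, forall x, f x \in M} &
     forall X, X \subset A :\: B -> #|X| <= #|neighbourhood r X :\: M|].
  have [[B [BA B0 BneA tight]]|slack] := pselect (exists B,
      [/\ B \subset A, B != set0, B != A & #|neighbourhood r B| <= #|B|]).
    have [] := IH r B.
    - rewrite ltnS in ltn; apply: leq_trans ltn; apply: proper_card.
      by rewrite properEneq BneA.
    - by move=> X XB; apply: hall; exact: subset_trans BA.
    move=> f [fr finj]; exists B, (neighbourhood r B), f; split=> //.
      by move=> x xB; apply/bigcupP; exists x => //; exact: fr.
    move=> X XAB; rewrite -(leq_add2r #|B|).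
    have XB0 : X :&: B = set0.
      apply/setP => x; rewrite !inE; apply/negP => /andP[/(subsetP XAB)].
      by rewrite inE => /andP[/negP].
    have /hall : X :|: B \subset A.
      by rewrite subUset BA (subset_trans XAB) ?subsetDl.
    rewrite -cardsUI XB0 cards0 addn0 => le; apply: leq_trans le _.
    rewrite /neighbourhood bigcup_setU setUC.
    rewrite -[X in X <= _](cardsID (neighbourhood r B)) setIUl.
    rewrite addnC leq_add //; last first.
      by apply: leq_trans tight; rewrite subset_leq_card // -setIUl subsetIr.
    by rewrite setDUl setDv set0U.
  have [u ua] : exists u, u \in r a.
    have := hall [set a]; rewrite sub1set aA cards1 => /(_ isT).
    by rewrite /neighbourhood big_set1 card_gt0 => /set0Pn.
  exists [set a], [set u], (fun=> u); split.
  - by rewrite sub1set.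
  - by apply/set0Pn; exists a; rewrite inE.
  - by split=> [x|x y]; rewrite !inE => /eqP -> // /eqP ->.
  - by move=> x _; rewrite inE.
  - move=> X XA; have [->|X0] := eqVneq X set0; first by rewrite cards0.
    have XA' : X \subset A := subset_trans XA (subsetDl _ _).
    have XneA : X != A.
      by apply: contraTneq aA => <-; apply/negP => /(subsetP XA);
        rewrite !inE eqxx.
    have : #|X| < #|neighbourhood r X|.
      by rewrite ltnNge; apply/negP => le; apply: slack; exists X.
    by rewrite (cardsD1 u (neighbourhood r X)); case: (u \in _);
      rewrite ?add0n // => /ltnW.
have [] := IH (fun x => r x :\: M) (A :\: B).
- rewrite ltnS in ltn; apply: leq_trans ltn; apply: proper_card.
  rewrite properEneq subsetDl andbT; have [b bB] := set0Pn _ B0.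
  by apply: contraTneq (subsetP BA _ bB) => <-; rewrite inE bB.
- by move=> X XAB; rewrite neighbourhoodD; apply: hallD.
move=> f' [f'r f'inj]; exists (fun x => if x \in B then f x else f' x).
have f'M x : x \in A -> x \notin B -> (f' x \in r x) /\ (f' x \notin M).
  move=> xA xB; have := f'r x; rewrite !inE xB xA => /(_ isT) /andP[].
  by [].
split=> [x xA|x y xA yA].
  have [xB|xB] := boolP (x \in B); first exact: fr.
  by have [] := f'M x xA xB.
have [xB|xB] := boolP (x \in B); have [yB|yB] := boolP (y \in B).
- exact: finj.
- by move=> E; have [_] := f'M y yA yB; rewrite -E fM.
- by move=> E; have [_] := f'M x xA xB; rewrite E fM.
- by apply: f'inj; rewrite inE ?xB ?yB.
Qed.
End Hall.

(** * From a permutation along edges to a factor, and from a factor to a cover *)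

Section Factors.
Variables (V : finType) (e : rel V).
Hypotheses (e_sym : symmetric e) (e_irr : irreflexive e).

(** Hall's theorem is applied to the bipartite double cover, in which every vertex has a copy on
    each side; a violation of its condition would let Staller win. *)
Lemma wins_injection : (forall a b p, ~ theta e a b p) ->
  wins e #|V| set0 set0 Staller ->
  exists2 sigma : V -> V, injective sigma & forall x, e x (sigma x).
Proof.
move=> noth win; pose r x := [set y | e x y].
have [X|sigma [sr sinj]] := @hall_marriage V V id r [set: V].
  move=> _; rewrite leqNgt; apply/negP => lt.
  set N := neighbourhood r X in lt.
  have NP x y : x \in X -> e x y -> y \in N.
    by move=> xX xy; apply/bigcupP; exists x => //; rewrite inE.
  (* Discarding [X :&: N] on both sides keeps the deficiency and makes the set independent: a vertex
     of [X] with a neighbour in [X] lies in [N]. *)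
  apply: (@surrounded_staller_wins _ e e_sym #|V| set0 set0 (X :\: N) (N :\: X)) => //.
  - by rewrite setU0 setC0 cardsT.
  - by rewrite set0I.
  - by rewrite setU0 -setI_eq0 setI0.
  - by rewrite -setI_eq0; apply/eqP/setP => u; rewrite !inE; case: (u \in N);
      rewrite ?andbF.
  split.
    move=> x v; rewrite !inE orbF => /andP[xN xX] xv; rewrite (NP x) // andbT.
    by apply: contraNN xN => vX; apply: (NP v); rewrite // e_sym.
  by move: lt; rewrite -(cardsID X N) -(cardsID N X) setIC ltn_add2l.
exists sigma; first by move=> x y; apply: sinj; rewrite inE.
by move=> x; have := sr x; rewrite !inE => /(_ isT).
Qed.

Lemma K2_rel_cycle : K2_rel =2 @cycle_rel 2.
Proof. by case=> [[|[|//]] ?] [[|[|//]] ?]. Qed.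

Lemma component_iso_K2 f (x : V) :
  component_iso f x K2_rel <-> component_iso f x (@cycle_rel 2).
Proof.
by split=> -[g [ginj gc gr]]; exists g; split=> // i j; rewrite gr K2_rel_cycle.
Qed.

(** Joining each vertex to its image makes the orbits of the permutation the components. There is no
    fixed point because [e] has no loops, and an orbit of length 2 is a single edge. *)
Lemma injection_factor (sigma : V -> V) : injective sigma ->
  (forall x, e x (sigma x)) -> exists f, perfect_12_factor e f.
Proof.
move=> sinj esig; pose f x y := (sigma x == y) || (sigma y == x).
have fsym : symmetric f by move=> x y; rewrite /f orbC.
exists f; split=> //.
  by move=> x y /orP[] /eqP <- //; rewrite e_sym.
move=> x; have ltk : 1 < order sigma x.
  rewrite ltn_neqAle order_gt0 andbT eq_sym; apply/negP => /eqP o1.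
  by have := iter_order sinj x; rewrite o1 /= => sx; have := esig x;
    rewrite sx e_irr.
suff iso : component_iso f x (@cycle_rel (order sigma x)).
  move: ltk iso; case: (order sigma x) => [|[|[|k]]] // _ iso.
    by left; apply/component_iso_K2.
  by right; exists k.+3.
have itE (i j : 'I_(order sigma x)) :
    (iter i sigma x == iter j sigma x) = (i == j :> nat).
  rewrite -!(nth_traject sigma (n := order sigma x)) //.
  by rewrite nth_uniq ?size_traject ?orbit_uniq.
have itS (i : 'I_(order sigma x)) : sigma (iter i sigma x) =
    iter (i.+1 %% order sigma x) sigma x.
  rewrite -iterS; have [lt|] := ltnP i.+1 (order sigma x);
    first by rewrite modn_small.
  move=> le; have -> : i.+1 = order sigma x by apply/eqP;
    rewrite eqn_leq le ltn_ord.
  by rewrite modnn iter_order.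
exists (fun i : 'I_(order sigma x) => iter i sigma x); split.
- by move=> i j /eqP; rewrite itE => /eqP /val_inj.
- move=> y; have -> : connect f x y = fconnect sigma x y.
    apply/idP/idP; apply: connect_sub => u v; last first.
      by move=> /eqP <-; apply: connect1; rewrite /f eqxx.
    case/orP => /eqP <-; first exact: fconnect1.
    by rewrite fconnect_sym // fconnect1.
  rewrite fconnect_orbit; split.
    by move=> /trajectP[i lt ->]; exists (Ordinal lt).
  by move=> [i <-]; apply/trajectP; exists i.
- have lt0 : 0 < order sigma x by apply: ltnW.
  have E (i j : 'I_(order sigma x)) : (sigma (iter i sigma x) == iter j sigma x) =
      (j == i.+1 %% order sigma x :> nat).
    rewrite itS; have lt := ltn_pmod i.+1 lt0.
    by rewrite (itE (Ordinal lt) j) /= eq_sym.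
  by move=> i j; rewrite /f !E.
Qed.

Lemma component_cycle (f : rel V) x n : 1 < n -> component_iso f x (@cycle_rel n) ->
  exists c, [/\ uniq c, cycle f c, 1 < size c & forall y, (y \in c) = connect f x y].
Proof.
case: n => // m lt1 [g [ginj gc gr]]; pose G k := g (inord k).
have GS k : k < m -> f (G k) (G k.+1).
  move=> km; rewrite gr /cycle_rel !inordK ?ltnS ?(ltnW km) //.
  by rewrite modn_small ?eqxx.
have Gm : f (G m) (G 0).
  by rewrite gr /cycle_rel !inordK // modnn eqxx.
exists [seq G i | i <- iota 0 m.+1]; split.
- rewrite map_inj_in_uniq ?iota_uniq // => i j.
  rewrite !mem_iota /= => im jm /ginj/(congr1 val) /=.
  by rewrite !inordK.
- rewrite /= rcons_path.
  have p k a : a + k <= m -> path f (G a) [seq G i | i <- iota a.+1 k].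
    elim: k a => //= k IH a le; rewrite GS; last first.
      by apply: leq_trans le; rewrite addnS ltnS leq_addr.
    by apply: IH; rewrite addSn -addnS.
  rewrite p // last_map.
  have last_iota k a : last a (iota a.+1 k) = a + k.
    by elim: k a => [|k IH] a /=; rewrite ?addn0 ?IH ?addSnnS.
  by rewrite last_iota.
- by rewrite size_map size_iota.
- move=> y; apply/mapP/idP => [[i _ ->]|/gc[i <-]].
    by apply/gc; exists (inord i).
  by exists (val i); rewrite ?mem_iota ?ltn_ord // /G inord_val.
Qed.

Lemma factor_cycle_cover f : perfect_12_factor e f ->
  exists L, cycle_cover e set0 set0 L.
Proof.
move=> [fsym fe comp].
have csym := sym_connect_sym fsym.
have cyc x : exists c,
    [/\ uniq c, cycle f c, 1 < size c & forall y, (y \in c) = connect f x y].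
  have [/component_iso_K2|[n n3]] := comp x; first exact: component_cycle.
  by apply: component_cycle; apply: leq_trans n3.
(* The components are collected by running through the vertices, skipping a vertex whose component
   is already listed. *)
suff [L [uL cL memL]] : exists L, [/\ uniq (flatten L),
    all (fun c => cycle e c && (1 < size c)) L
    & forall y, y \in flatten L <-> exists2 x, x \in enum V & connect f x y].
  exists L; split=> // v.
    by rewrite inE.
  by move=> /negP[]; apply/memL; exists v; rewrite ?mem_enum.
elim: (enum V) => [|x s [L [uL cL memL]]].
  by exists [::]; split=> // y; split=> // -[].
have [xL|xL] := boolP (x \in flatten L).
  exists L; split=> // y; split=> [/memL[z zs zy]|[z]].
    by exists z; rewrite // in_cons zs orbT.
  rewrite in_cons => /orP[/eqP ->|zs] zy; last by apply/memL; exists z.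
  have [u us ux] := (memL x).1 xL.
  by apply/memL; exists u => //; apply: connect_trans ux zy.
have [c [uc cyc_c sc memc]] := cyc x; exists (c :: L); split.
- rewrite /= cat_uniq uc uL andbT /=; apply/hasPn => y /memL[z zs zy].
  rewrite /= memc; apply: contraNN xL => xy; apply/memL; exists z => //.
  by apply: connect_trans zy _; rewrite csym.
- by rewrite /= cL sc !andbT; apply: sub_cycle cyc_c.
- move=> y; rewrite /= mem_cat memc; split.
    case/orP => [xy|/memL[z zs zy]]; first by exists x; rewrite ?mem_head.
    by exists z; rewrite // in_cons zs orbT.
  move=> [z]; rewrite in_cons => /orP[/eqP ->|zs] zy; first by rewrite zy.
  by apply/orP; right; apply/memL; exists z.
Qed.

End Factors.

From mathcomp Require Import all_classical all_reals all_analysis.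

Import Order.TTheory GRing.Theory Num.Theory.
Import numFieldNormedType.Exports.

(** * Thetas in outerplanar drawings *)

Section Turns.
Local Open Scope ring_scope.
Variable R : realType.
Notation plane := (R * R)%type.
Implicit Types (r d : R) (u v w x y : plane) (s t : seq plane).

Definition close r u v := (`|u.1 - v.1| < r) && (`|u.2 - v.2| < r).

(** A half-plane with half of its boundary line, so that it contains exactly one of [v] and [- v]
    whenever [v] is nonzero. *)
Definition upper v := (0 < v.2) || ((v.2 == 0) && (0 < v.1)).

(** For a short step far from 0, this tells whether it crosses the negative horizontal half-axis.
    Along a closed chain the parity of crossings is that of the winding number around 0. *)
Definition crossing v w := (upper v (+) upper w) && (v.1 < 0).

Fixpoint turns (f : plane -> plane) x s : bool :=
  if s is y :: s' then crossing (f x) (f y) (+) turns f y s' else false.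

(** These two maps give the vector P_j - P_i: [to_point z] when P_j rests at [z] and P_i moves,
    [from_point z] when P_i rests at [z] and P_j moves. *)
Definition to_point z w : plane := z - w.
Definition from_point z w : plane := w - z.

Lemma close_sym r u v : close r u v = close r v u.
Proof. by rewrite /close distrC [in X in _ && X]distrC. Qed.

Lemma close_refl r u : 0 < r -> close r u u.
Proof. by move=> r0; rewrite /close !subrr normr0 r0. Qed.

Lemma close_trans d1 d2 r u v w :
  close d1 u v -> close d2 v w -> d1 + d2 <= r -> close r u w.
Proof.
move=> /andP[a1 a2] /andP[b1 b2] h; apply/andP; split.
  by rewrite (le_lt_trans (ler_distD v.1 _ _)) //; lra.
by rewrite (le_lt_trans (ler_distD v.2 _ _)) //; lra.
Qed.

Lemma close_le d r u v : close d u v -> d <= r -> close r u v.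
Proof. by move=> /andP[a b] h; rewrite /close !(lt_le_trans _ h). Qed.

Lemma path_close_le d r x s :
  path (close d) x s -> d <= r -> path (close r) x s.
Proof. by move=> + h; apply: sub_path => u v uv; apply: close_le uv h. Qed.

Lemma closeB r u v z : close r (u - z) (v - z) = close r u v.
Proof.
by rewrite /close /= !opprB !addrA !subrK.
Qed.

Lemma close_subl r u v z : close r (z - u) (z - v) = close r v u.
Proof.
have h (a b c : R) : a - b - (a - c) = c - b by lra.
by rewrite /close /= !h.
Qed.

Lemma close_sub0 r u z : close r (u - z) 0 = close r u z.
Proof. by rewrite /close /= !subr0. Qed.

Lemma upperN v : v != 0 -> upper (- v) = ~~ upper v.
Proof.
case: v => a b; rewrite /upper /= oppr_gt0 oppr_eq0 oppr_gt0 => h.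
case: (ltgtP b 0) => //= b0.
case: (ltgtP a 0) => //= a0.
by move: h; rewrite a0 b0 eqxx.
Qed.

(** The ordinates of [u] and [v] have opposite signs or vanish, so that of [u] is below [r] in
    absolute value; only its abscissa can keep [u] away from 0. *)
Lemma upper_neq_far r u v :
  close r u v -> ~~ close r u 0 -> upper u != upper v -> r <= `|u.1|.
Proof.
case: u v => a b [a' b']; rewrite /close /upper /= !subr0 negb_and -!leNgt.
move=> /andP[_ +] /orP[//|+]; rewrite ltr_norml => /andP[h1 h3].
case: (ltrgtP b 0) => [b0|b0|b0] h2; rewrite /=.
- by case: (ltrgtP b' 0) => [b0'|b0'|b0'] //= _; move: h2;
    rewrite ltr0_norm //; lra.
- by case: (ltrgtP b' 0) => [b0'|b0'|b0'] //= _; move: h2;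
    rewrite gtr0_norm //; lra.
- by move: h2; rewrite b0 normr0 => h2 _; apply: le_trans h2 _.
Qed.

Lemma close_same_sign r u v :
  close r u v -> r <= `|u.1| -> (u.1 < 0) = (v.1 < 0).
Proof.
move=> /andP[+ _]; move: u.1 v.1 => a b h1 h2; apply/idP/idP => h.
  by move: h2 h1; rewrite ltr0_norm // ltr_norml => ? /andP[? ?]; lra.
rewrite ltNge; apply/negP => h'.
by move: h2 h1; rewrite ger0_norm // ltr_norml => ? /andP[? ?]; lra.
Qed.

Lemma upper_change_sign r u v w :
  close r u v -> ~~ close r u 0 -> upper u != upper v ->
  close r u w -> (u.1 < 0) = (w.1 < 0).
Proof.
by move=> uv u0 h uw; apply: close_same_sign uw (upper_neq_far uv u0 h).
Qed.

(** A small triangle far from 0 does not wind around it: where [upper] changes, all corners lie on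
    the same side of the vertical axis. *)
Lemma crossing_triangle r u v w :
  close r u v -> close r v w -> close r u w ->
  ~~ close r u 0 -> ~~ close r v 0 ->
  crossing u v (+) crossing v w = crossing u w.
Proof.
move=> uv vw uw u0 v0; rewrite /crossing.
have [e1|n1] := eqVneq (upper u) (upper v).
  have [e2|n2] := eqVneq (upper v) (upper w); first by rewrite e1 e2 !addbb.
  rewrite -e1 addbb /=; congr (_ && _); apply/esym.
  by rewrite close_sym in uv; rewrite (upper_change_sign vw v0 n2 uv).
rewrite -(upper_change_sign uv u0 n1 uv).
by case: (upper u) (upper v) (upper w) (u.1 < 0) => [] [] [] [].
Qed.

Lemma crossing_square r u v u' v' :
  close r u v -> close r u' v' -> close r u u' -> close r v v' ->
  close r u v' ->
  ~~ close r u 0 -> ~~ close r v 0 -> ~~ close r u' 0 ->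
  crossing u v (+) crossing v v' = crossing u u' (+) crossing u' v'.
Proof.
move=> uv uv' uu' vv' d u0 v0 u0'.
by rewrite (crossing_triangle (r := r)) // (crossing_triangle (r := r)).
Qed.

(** The steps from [u] to [v] and from [- u] to [- v] test the two horizontal half-axes; exactly one
    of them counts when [upper] changes. *)
Lemma crossingN r u v :
  close r u v -> ~~ close r u 0 -> ~~ close r v 0 -> 0 < r ->
  crossing u v (+) crossing (- u) (- v) = upper u (+) upper v.
Proof.
move=> uv u0 v0 r0; rewrite /crossing.
have n0 x : ~~ close r x 0 -> x != 0.
  by apply: contraNneq => ->; rewrite close_refl.
rewrite !upperN ?n0 //.
have [->|n1] := eqVneq (upper u) (upper v); first by rewrite !addbb.
have := upper_neq_far uv u0 n1.
rewrite /= oppr_lt0; case: (ltgtP u.1 0) => [_|_|->].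
- by case: (upper u) (upper v) => [] [].
- by case: (upper u) (upper v) => [] [].
- by rewrite normr0 leNgt r0.
Qed.

Lemma turns_cat f x s t :
  turns f x (s ++ t) = turns f x s (+) turns f (last x s) t.
Proof. by elim: s x => //= y s IH x; rewrite IH addbA. Qed.

(* Replacing f by g sweeps a ladder of small squares along the chain. *)
Lemma turns_ladder r f g x s :
  (forall y, y \in x :: s ->
     [&& close r (f y) (g y), ~~ close r (f y) 0 & ~~ close r (g y) 0]) ->
  path (fun y y' => [&& close r (f y) (f y'), close r (g y) (g y') &
                        close r (f y) (g y')]) x s ->
  turns f x s (+) crossing (f (last x s)) (g (last x s)) =
  crossing (f x) (g x) (+) turns g x s.
Proof.
elim: s x => [|y s IH] x h /=; first by rewrite addbC.
move=> /andP[/and3P[a1 a2 a3] p].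
rewrite -addbA IH //; last by move=> z zs; apply: h; rewrite in_cons zs orbT.
have /and3P[b1 b2 b3] := h _ (mem_head _ _).
have /and3P[c1 c2 c3] : [&& close r (f y) (g y), ~~ close r (f y) 0 &
   ~~ close r (g y) 0] by apply: h; rewrite !in_cons eqxx orbT.
rewrite !addbA; congr (_ (+) _).
exact: (crossing_square (r := r)).
Qed.

Lemma turns_move_point d r z z' x s :
  d + d <= r -> close d z z' -> path (close d) x s ->
  (forall y, y \in x :: s -> ~~ close r y z && ~~ close r y z') -> 0 < d ->
  turns (from_point z) x s
    (+) crossing (from_point z (last x s)) (from_point z' (last x s)) =
  crossing (from_point z x) (from_point z' x) (+) turns (from_point z') x s.
Proof.
move=> dr zz' ps far d0; apply: (turns_ladder (r := r)).
  move=> y /far /andP[h1 h2]; rewrite /from_point !close_sub0 h1 h2 !andbT.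
  by rewrite close_subl close_sym (close_le zz') //; lra.
apply: sub_path ps => y y' yy'; rewrite /from_point !closeB.
have yr : close r y y' by rewrite (close_le yy') //; lra.
rewrite yr /=; apply: (close_trans (v := y' - z) (d1 := d) (d2 := d)) => //.
  by rewrite closeB.
by rewrite close_subl close_sym.
Qed.

Lemma turns_short r f x s :
  (forall y y', y \in x :: s -> y' \in x :: s -> close r (f y) (f y')) ->
  (forall y, y \in x :: s -> ~~ close r (f y) 0) ->
  turns f x s = crossing (f x) (f (last x s)).
Proof.
elim: s x => [|y s IH] x h1 h2 /=.
  by rewrite /crossing addbb.
have sub z : z \in y :: s -> z \in x :: y :: s by move=> hz;
  rewrite in_cons hz orbT.
rewrite IH; last 2 first.
- by move=> u u' /sub hu /sub hu'; apply: h1.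
- by move=> u /sub; apply: h2.
have yi : y \in x :: y :: s by rewrite sub ?mem_head.
have li : last y s \in x :: y :: s by rewrite sub ?mem_last.
have xi : x \in x :: y :: s by rewrite mem_head.
by apply: (crossing_triangle (r := r));
  [apply: h1|apply: h1|apply: h1|apply: h2|apply: h2].
Qed.

(** Summing [crossingN] along the chain, the changes of [upper] telescope. *)
Lemma turnsN r z x s : 0 < r ->
  path (close r) x s -> (forall y, y \in x :: s -> ~~ close r y z) ->
  turns (from_point z) x s (+) turns (to_point z) x s =
  upper (x - z) (+) upper (last x s - z).
Proof.
move=> r0; elim: s x => [|y s IH] x /=; first by rewrite addbb.
move=> /andP[xy p] far.
rewrite addbACA IH //; last by move=> u us; apply: far; rewrite in_cons us orbT.
have := @crossingN r (x - z) (y - z).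
rewrite !opprB closeB => -> //.
- by rewrite !addbA addbK.
- by rewrite close_sub0 far // mem_head.
- by rewrite close_sub0 far // !in_cons eqxx orbT.
Qed.

Definition apart r s t := {in s & t, forall x y, ~~ close r x y}.

(** Two points that never collide may move in either order. Induction on [t], with one ladder along
    [s] for each step of [t]. *)
Lemma turns_rectangle d r x s y t : 0 < d -> d + d <= r ->
  path (close d) x s -> path (close d) y t -> apart r (x :: s) (y :: t) ->
  turns (to_point y) x s (+) turns (from_point (last x s)) y t =
  turns (from_point x) y t (+) turns (to_point (last y t)) x s.
Proof.
move=> d0 dr ps; elim: t y => [|y' t IH] y /=; first by rewrite addbF.
move=> /andP[yy' pt] ap.
have ap' : apart r (x :: s) (y' :: t).
  by move=> u v hu hv; apply: ap => //; rewrite in_cons hv orbT.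
have far u v : u \in x :: s -> v \in [:: y; y'] -> ~~ close r (v - u) 0.
  move=> hu hv; rewrite close_sub0 close_sym.
  by apply: ap => //; move: hv; rewrite !inE => /orP[] ->; rewrite ?orbT.
rewrite addbCA -addbA.
have -> : crossing (from_point (last x s) y) (from_point (last x s) y') (+)
  (turns (to_point y) x s (+) turns (from_point (last x s)) y' t) =
  crossing (from_point x y) (from_point x y') (+)
  (turns (to_point y') x s (+) turns (from_point (last x s)) y' t).
  rewrite !addbA; congr (_ (+) _); rewrite addbC.
  apply: (turns_ladder (r := r) (f := to_point y) (g := to_point y')).
    move=> u hu; rewrite /to_point !far ?inE ?eqxx ?orbT // closeB.
    by rewrite (close_le yy') //; lra.
  apply: sub_path ps => u u' uu'; rewrite /to_point !close_subl.
  have -> : close r u' u by rewrite close_sym (close_le uu') //; lra.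
  rewrite /=; apply: (close_trans (v := y' - u) (d1 := d) (d2 := d)) => //.
    by rewrite closeB.
  by rewrite close_subl close_sym.
by rewrite IH // -!addbA.
Qed.

End Turns.

(** * Three paths in the plane with interior points on the boundary of an unbounded region *)

Section ThetaPlane.
Local Open Scope classical_set_scope.
Local Open Scope ring_scope.
Variable R : realType.
Notation plane := (R * R)%type.
Implicit Types (r d : R) (u v w x y z : plane) (s t : seq plane).
Implicit Types (A B K F S : set plane) (a b zi zj : plane).
Implicit Types (sai sbi saj sbj : seq plane).

(* Parity of the half turns of v = P_j - P_i while (P_i, P_j) goes from (a, b)
   to (b, a), where P_i consists of a chain sa from a to zi and a chain sb from
   zi to b: first P_i moves to zi, then P_j moves from b to a, then P_i moves
   to b. *)
Definition swap_turns a b zi sai sbi zj saj sbj : bool :=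
  turns (to_point b) a sai (+) turns (from_point zi) zj sbj (+)
  (turns (from_point zi) a saj (+) turns (to_point a) zi sbi).

(** Two rectangles reorder the moves behind the first count, which then runs over the same chains as
    the second with the opposite vector. By [turnsN] their sum reduces to changes of [upper], and
    these add up to 1 because [upper] separates opposite vectors. *)
Lemma swap_turnsC d r a b zi sai sbi zj saj sbj :
  0 < d -> d + d <= r ->
  path (close d) a sai -> path (close d) zi sbi ->
  path (close d) a saj -> path (close d) zj sbj ->
  last a sai = zi -> last zi sbi = b -> last a saj = zj -> last zj sbj = b ->
  apart r (a :: sai) (zj :: sbj) -> apart r (zi :: sbi) (a :: saj) ->
  swap_turns a b zi sai sbi zj saj sbj (+) swap_turns a b zj saj sbj zi sai sbi.
Proof.
move=> d0 dr pai pbi paj pbj lai lbi laj lbj apij apji.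
have r0 : 0 < r by lra.
have dler : d <= r by lra.
have wk x s (p : path (close d) x s) := path_close_le p dler.
have aai : a \in a :: sai by rewrite mem_head.
have aaj : a \in a :: saj by rewrite mem_head.
have ziai : zi \in a :: sai by rewrite -lai mem_last.
have zjaj : zj \in a :: saj by rewrite -laj mem_last.
have bbi : b \in zi :: sbi by rewrite -lbi mem_last.
have bbj : b \in zj :: sbj by rewrite -lbj mem_last.
have zjbj : zj \in zj :: sbj by rewrite mem_head.
have R1 := turns_rectangle d0 dr pai pbj apij.
have R2 := turns_rectangle d0 dr pbi paj apji.
rewrite lai lbj in R1; rewrite lbi laj in R2.
have N1 : turns (from_point b) a saj (+) turns (to_point b) a saj =
    upper (a - b) (+) upper (zj - b).
  rewrite (turnsN r0) ?wk ?laj // => y hy.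
  by rewrite close_sym; apply: apji.
have N2 : turns (from_point zj) a sai (+) turns (to_point zj) a sai =
    upper (a - zj) (+) upper (zi - zj).
  by rewrite (turnsN r0) ?wk ?lai // => y hy; apply: apij.
have N3 : turns (from_point zj) zi sbi (+) turns (to_point zj) zi sbi =
    upper (zi - zj) (+) upper (b - zj).
  by rewrite (turnsN r0) ?wk ?lbi // => y hy; apply: apji.
have N4 : turns (from_point a) zj sbj (+) turns (to_point a) zj sbj =
    upper (zj - a) (+) upper (b - a).
  rewrite (turnsN r0) ?wk ?lbj // => y hy.
  by rewrite close_sym; apply: apij.
have ne u v : ~~ close r u v -> v - u != 0.
  by rewrite subr_eq0; apply: contraNneq => ->; rewrite close_refl.
have opp u v : ~~ close r u v -> upper (u - v) = ~~ upper (v - u).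
  by move=> h; rewrite -opprB upperN ?ne.
rewrite (opp a b) ?apij // (opp b zj) ?apji // in N1 N3.
rewrite (opp a zj) ?apij // in N2.
move: R1 R2 N1 N2 N3 N4; rewrite /swap_turns.
set t1 := turns (to_point b) a sai; set f1 := turns (from_point zi) zj sbj.
set f2 := turns (from_point zi) a saj; set t2 := turns (to_point a) zi sbi.
set g1 := turns (to_point zj) a sai; set g2 := turns (from_point a) zj sbj.
set g3 := turns (from_point b) a saj; set g4 := turns (to_point zj) zi sbi.
move=> R1 R2.
have -> : t1 (+) f1 = g1 (+) g2.
  by move: R1; case: t1 f1 g1 g2 => [] [] [] [].
have -> : f2 (+) t2 = g3 (+) g4.
  by move: R2; case: f2 t2 g3 g4 => [] [] [] [].
move: (turns _ _ _) (turns _ _ _) (turns _ _ _) (turns _ _ _).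
move=> c1 c2 c3 c4.
case: g1 g2 g3 g4 {R1 R2} => [] [] [] [];
case: c1 c2 c3 c4 => [] [] [] [] //=;
by case: (upper _) (upper _) (upper _) (upper _) => [] [] [] [].
Qed.

Lemma ball_closeE u r v : ball u r v = close r u v :> Prop.
Proof.
rewrite propeqE; split=> [[h1 h2]|/andP[h1 h2]]; last by split.
by rewrite /close h1 h2.
Qed.

(** Locally all points are equivalent, so each class is relatively open, hence also relatively
    closed. This serves both for chains and for the invariance of winding parities. *)
Lemma connected_equivalence S (Q : plane -> plane -> Prop) :
  connected S -> (forall x y, Q x y -> Q y x) ->
  (forall x y z, Q x y -> Q y z -> Q x z) ->
  (forall x, S x -> exists2 r, 0 < r & forall y, S y -> close r x y -> Q x y) ->
  forall x y, S x -> S y -> Q x y.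
Proof.
move=> cS Qs Qt Ql x y Sx Sy.
(* For [P] a union of classes, [G P] is an open set of the plane whose trace on [S] is that of
   [P]. *)
pose G (P : plane -> Prop) := \bigcup_(yr in [set yr : plane * R |
  [/\ 0 < yr.2, S yr.1, P yr.1 &
    forall y', S y' -> close yr.2 yr.1 y' -> Q yr.1 y']])
    (ball yr.1 yr.2)°.
have oG P : open (G P) by apply: bigcup_open => yr _; exact: open_interior.
have GP P w : S w -> P w -> G P w.
  move=> Sw Pw; have [r r0 hr] := Ql _ Sw.
  by exists (w, r) => //=; apply: nbhsx_ballx.
have GQ P w : S w -> G P w -> exists2 u, P u & Q u w.
  move=> Sw [[u r] /= [_ _ Pu hr] /interior_subset /=].
  by rewrite ball_closeE => /hr h; exists u => //; exact: h.
pose B := [set w | S w /\ Q x w].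
have Qx : Q x x by have [r r0 hr] := Ql _ Sx; apply: hr => //;
  rewrite close_refl.
suff BS : B = S by have [] : B y by rewrite BS.
apply: cS.
- by exists x.
- exists (G (Q x)) => //; apply/seteqP; split=> w /= [Sw h]; split=> //.
    exact: GP.
  by have [u h1 h2] := GQ _ _ Sw h; apply: Qt h1 h2.
- exists (~` G (fun w => ~ Q x w)); first exact: open_closedC.
  apply/seteqP; split=> w /= [Sw h]; split=> //.
    move=> /(GQ _ _ Sw)[u h1 h2]; apply: h1.
    by apply: Qt h _; apply: Qs.
  by apply: contrapT => h'; apply: h; apply: GP.
Qed.

Lemma closed_far K z : closed K -> ~ K z ->
  exists2 r, 0 < r & forall w, K w -> ~~ close r z w.
Proof.
move=> cK Kz.
have : nbhs z (~` K) by apply: open_nbhs_nbhs; split=> //; exact: closed_openC.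
move=> /nbhs_ballP[r /= r0 hr]; exists r => // w Kw.
by apply/negP => h; apply: (hr w) => //; rewrite ball_closeE.
Qed.

Lemma compact_apart A B : compact A -> closed B -> A `&` B = set0 ->
  exists2 r, 0 < r & forall u v, A u -> B v -> ~~ close r u v.
Proof.
move=> /compact_near_coveringP cA cB AB.
pose P r u := forall v, B v -> ~~ close r u v.
have nearP : \forall r \near (0 : R)^'+, A `<=` P r.
  apply: cA => u Au.
  have [|r r0 hr] := closed_far (z := u) cB.
    by move=> Bu; have : (A `&` B) u by []; rewrite AB.
  have r2 : 0 < r / 2 by lra.
  exists (ball u (r / 2), [set e | e <= r / 2]); first split=> /=.
  - exact: nbhsx_ballx.
  - by near=> e; apply: ltW; near: e; exact: nbhs_right_lt.
  move=> [u' e] /= [+ he] v Bv; rewrite ball_closeE => uu'.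
  apply: contra (hr v Bv) => u'v; apply: close_trans uu' u'v _.
  by move: he => /=; lra.
suff [r [r0 hr]] : exists r, 0 < r /\ A `<=` P r.
  by exists r => // u v Au; exact: hr.
near (0 : R)^'+ => r; exists r; split; first by near: r; exact: nbhs_right_gt.
by near: r.
Unshelve. all: by end_near. Qed.

Lemma connected_chain A d x y : connected A -> 0 < d -> A x -> A y ->
  exists s, [/\ path (close d) x s, last x s = y &
                forall w, w \in x :: s -> A w].
Proof.
move=> cA d0 Ax Ay; pose Q x y := exists s, [/\ path (close d) x s,
  last x s = y & forall w, w \in x :: s -> A w].
suff : Q x y by [].
apply: connected_equivalence cA _ _ _ x y Ax Ay.
- move=> x y [s [p l hs]]; exists (rev (belast x s)); split.
  + rewrite -l rev_path; apply: sub_path p => u v /=.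
    by rewrite close_sym.
  + by case: s {p hs} l => //= z s _; rewrite rev_cons last_rcons.
  + by move=> w; rewrite -l -rev_rcons -lastI mem_rev; exact: hs.
- move=> x y z [s [ps ls hs]] [t [pt lt ht]]; exists (s ++ t); split.
  + by rewrite cat_path ps ls.
  + by rewrite last_cat ls.
  + move=> w; rewrite -cat_cons mem_cat => /orP[/hs //|wt].
    by apply: ht; rewrite in_cons wt orbT.
- move=> x Ax; exists d => // y Ay xy; exists [:: y]; split=> //=.
    by rewrite xy.
  by move=> w; rewrite !inE => /orP[] /eqP ->.
Qed.

(* The parity of the winding number around z of loops in K is that around z'. *)
Definition same_turns K z z' := exists2 d, 0 < d & forall x s t,
  path (close d) x s -> path (close d) x t -> last x s = last x t ->
  (forall w, w \in x :: s -> K w) -> (forall w, w \in x :: t -> K w) ->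
  turns (from_point z) x s (+) turns (from_point z) x t =
  turns (from_point z') x s (+) turns (from_point z') x t.

Lemma same_turns_near K z : closed K -> ~ K z ->
  exists2 r, 0 < r & forall z', close r z z' -> same_turns K z z'.
Proof.
move=> cK Kz; have [r r0 hr] := closed_far cK Kz.
(* With a displacement below r / 4, both [z] and [z'] keep [K] at distance at least r / 2, which is
   twice the mesh r / 4, as the ladder requires. *)
have r4 : 0 < r / 4 by lra.
exists (r / 4) => // z' zz'; exists (r / 4) => // x s t ps pt lst hs ht.
have far w : K w -> ~~ close (r / 2) w z && ~~ close (r / 2) w z'.
  move=> Kw; apply/andP; split.
    by rewrite close_sym; apply: contra (hr _ Kw) => h; apply: close_le h _;
      lra.
  rewrite close_sym; apply: contra (hr _ Kw) => h; apply: close_trans zz' h _.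
  lra.
have rr : r / 4 + r / 4 <= r / 2 by lra.
have h1 := turns_move_point rr zz' ps (fun w hw => far w (hs w hw)) r4.
have h2 := turns_move_point rr zz' pt (fun w hw => far w (ht w hw)) r4.
move: h1 h2; rewrite lst.
case: (crossing _ _) (crossing _ _) (turns _ _ _) (turns _ _ _)
  (turns _ _ _) (turns _ _ _) => [] [] [] [] [] [] //.
Qed.

Lemma same_turns_connected K F z z' : closed K -> connected F ->
  (forall w, F w -> ~ K w) -> F z -> F z' -> same_turns K z z'.
Proof.
move=> cK cF FK Fz Fz'; apply: connected_equivalence cF _ _ _ z z' Fz Fz'.
- move=> x y [d d0 h]; exists d => // u s t *; apply/esym; exact: h.
- move=> x y u [d d0 h] [d' d'0 h'].
  have m0 : 0 < Num.min d d' by rewrite lt_min d0.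
  exists (Num.min d d') => // v s t ps pt lst hs ht.
  have le1 : Num.min d d' <= d by rewrite ge_min lexx.
  have le2 : Num.min d d' <= d' by rewrite ge_min lexx orbT.
  exact: etrans (h _ _ _ (path_close_le ps le1) (path_close_le pt le1) lst hs ht)
                (h' _ _ _ (path_close_le ps le2) (path_close_le pt le2) lst hs ht).
- move=> x /FK Kx; have [r r0 hr] := same_turns_near cK Kx.
  by exists r => // y _; exact: hr.
Qed.

Lemma prod_norm_lt w r : (`|w| < r) = (`|w.1| < r) && (`|w.2| < r).
Proof. by rewrite prod_normE gt_max. Qed.

Lemma unbounded_far F M : ~ bounded_set F ->
  exists2 w, F w & (M < `|w.1|) || (M < `|w.2|).
Proof.
move=> uF; apply: contrapT => h; apply: uF.
exists M; split; first exact: num_real.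
move=> x Mx w Fw; apply: ltW; rewrite prod_norm_lt.
apply: contrapT => /negP; rewrite negb_and -!leNgt => h'; apply: h.
by exists w => //; case/orP: h' => /(lt_le_trans Mx) ->; rewrite ?orbT.
Qed.

(** The parity is unchanged when [z] moves to a nearby point of [F] and then inside [F] to a point
    [c] far from [K]. Seen from [c], the whole of [K] is one short step, so chains with common ends
    agree. *)
Lemma outside_turns K F z : compact K -> connected F -> ~ bounded_set F ->
  (forall w, F w -> ~ K w) -> ~ K z -> closure F z ->
  exists2 d, 0 < d & forall x s t,
  path (close d) x s -> path (close d) x t -> last x s = last x t ->
  (forall w, w \in x :: s -> K w) -> (forall w, w \in x :: t -> K w) ->
  turns (from_point z) x s = turns (from_point z) x t.
Proof.
move=> kK cF uF FK Kz clz.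
have cK : closed K by apply: compact_closed kK; exact: norm_hausdorff.
have [r r0 hr] := same_turns_near cK Kz.
have [z0 [Fz0 zz0]] := clz _ (nbhsx_ballx z r r0).
rewrite ball_closeE in zz0.
have [M [_ /(_ (`|M| + 1)) hM]] := compact_bounded kK.
have M1 : M < `|M| + 1 by rewrite (le_lt_trans (ler_norm M)) //; lra.
have Kb w : K w -> (`|w.1| <= `|M| + 1) /\ (`|w.2| <= `|M| + 1).
  by move=> /(hM M1) /=; rewrite prod_normE ge_max => /andP[].
set m := `|M| + 1 in Kb.
have m0 : 0 < m by rewrite ltr_wpDl.
have [c Fc cfar] := unbounded_far (4 * m) uF.
have [d1 d10 h1] := hr _ zz0.
have [d2 d20 h2] := same_turns_connected cK cF FK Fz0 Fc.
have e0 : 0 < Num.min d1 d2 by rewrite lt_min d10.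
exists (Num.min d1 d2) => // x s t ps pt lst hs ht.
suff : turns (from_point z) x s (+) turns (from_point z) x t = false.
  by case: (turns _ _ s) (turns _ _ t) => [] [].
have le1 : Num.min d1 d2 <= d1 by rewrite ge_min lexx.
have le2 : Num.min d1 d2 <= d2 by rewrite ge_min lexx orbT.
have -> := h1 _ _ _ (path_close_le ps le1) (path_close_le pt le1) lst hs ht.
have -> := h2 _ _ _ (path_close_le ps le2) (path_close_le pt le2) lst hs ht.
(* [K] lies in the box of half-width [m] and a coordinate of [c] exceeds 4m, so [K] is more than 3m
   away from [c] while its diameter is at most 2m; 5m/2 lies in between. *)
have far w : K w -> ~~ close (2 * m + 2^-1 * m) (w - c) 0.
  move=> /Kb[w1 w2]; rewrite close_sub0 negb_and -!leNgt.
  case/orP: cfar => hc; apply/orP; [left|right].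
    by have := ler_distD w.1 c.1 0; rewrite !subr0 (distrC c.1); lra.
  by have := ler_distD w.2 c.2 0; rewrite !subr0 (distrC c.2); lra.
have near w w' : K w -> K w' -> close (2 * m + 2^-1 * m) (w - c) (w' - c).
  move=> /Kb[w1 w2] /Kb[w'1 w'2]; rewrite closeB.
  by apply/andP; split; rewrite (le_lt_trans (ler_normB _ _)) //; lra.
rewrite (turns_short (r := 2 * m + 2^-1 * m)); last 2 first.
- by move=> y y' /hs ? /hs ?; apply: near.
- by move=> y /hs ?; apply: far.
rewrite (turns_short (r := 2 * m + 2^-1 * m)); last 2 first.
- by move=> y y' /ht ? /ht ?; apply: near.
- by move=> y /ht ?; apply: far.
by rewrite lst addbb.
Qed.

Lemma uniform_pos (T : finType) (P : T -> R -> Prop) :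
  (forall i d d', 0 < d' -> d' <= d -> P i d -> P i d') ->
  (forall i, exists2 d, 0 < d & P i d) -> exists2 d, 0 < d & forall i, P i d.
Proof.
move=> mono ex.
suff [d d0 hd] : exists2 d, 0 < d & forall i, i \in enum T -> P i d.
  by exists d => // i; apply: hd; rewrite mem_enum.
elim: (enum T) => [|i l [d d0 IH]]; first by exists 1.
have [d' d'0 Pd'] := ex i.
have m0 : 0 < Num.min d d' by rewrite lt_min d0.
exists (Num.min d d') => // j; rewrite in_cons => /orP[/eqP ->|/IH h].
  by apply: mono Pd' => //; rewrite ge_min lexx orbT.
by apply: mono h => //; rewrite ge_min lexx.
Qed.

(** [A i] and [B i] are the halves of P_i before and after [z i]. Halves of the same kind share an
    end, so only opposite halves of different paths are kept disjoint; the motion of [swap_turns]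
    never needs more, and [z i], lying in both halves, is off the other paths. *)
Theorem theta_plane (a b : plane) (z : 'I_3 -> plane) (A B : 'I_3 -> set plane) F :
  (forall i, compact (A i)) -> (forall i, compact (B i)) ->
  (forall i, connected (A i)) -> (forall i, connected (B i)) ->
  (forall i, A i a) -> (forall i, A i (z i)) ->
  (forall i, B i (z i)) -> (forall i, B i b) ->
  (forall i j, i != j -> A i `&` B j = set0) ->
  connected F -> ~ bounded_set F ->
  (forall i w, F w -> ~ A i w /\ ~ B i w) -> (forall i, closure F (z i)) ->
  False.
Proof.
move=> kA kB cA cB Aa Az Bz Bb AB cF uF FAB clz.
have nAB i j w : i != j -> A i w -> ~ B j w.
  by move=> ij Aw Bw; have : (A i `&` B j) w by []; rewrite AB.
have [r r0 hr] : exists2 r, 0 < r & forall ij : 'I_3 * 'I_3, ij.1 != ij.2 ->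
    forall u v, A ij.1 u -> B ij.2 v -> ~~ close r u v.
  apply: uniform_pos => [ij d d' d'0 d'd h ne u v Au Bv|[i j]].
    by apply: contra (h ne u v Au Bv) => /close_le; apply.
  have [->|ij] := eqVneq i j; first by exists 1 => //=; rewrite eqxx.
  have cBj : closed (B j) by apply: compact_closed (kB j);
    exact: norm_hausdorff.
  by have [r r0 h] := compact_apart (kA i) cBj (AB i j ij); exists r.
pose K j k := A j `|` B j `|` (A k `|` B k).
have [d1 d10 hd1] : exists2 d, 0 < d & forall t : 'I_3 * 'I_3 * 'I_3,
    let: (i, j, k) := t in i != j -> i != k -> forall x s t,
    path (close d) x s -> path (close d) x t -> last x s = last x t ->
    (forall w, w \in x :: s -> K j k w) -> (forall w, w \in x :: t -> K j k w) ->
    turns (from_point (z i)) x s = turns (from_point (z i)) x t.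
  apply: uniform_pos => [[[i j] k] d d' d'0 d'd h ij ik x s t ps pt|[[i j] k]].
    by apply: h => //;
      [apply: path_close_le ps d'd|apply: path_close_le pt d'd].
  have [->|ij] := eqVneq i j; first by exists 1.
  have [->|ik] := eqVneq i k; first by exists 1.
  have kK : compact (K j k) by apply: compactU; apply: compactU.
  have [] := @outside_turns (K j k) F (z i) kK cF uF.
  - by move=> w /[dup] /(FAB j)[? ?] /(FAB k)[? ?] [[]|[]].
  - move=> [[h|h]|[h|h]].
    + by apply: (nAB j i (z i)) => //; rewrite eq_sym.
    + exact: (nAB i j (z i)).
    + by apply: (nAB k i (z i)) => //; rewrite eq_sym.
    + exact: (nAB i k (z i)).
  - exact: clz.
  by move=> d d0 h; exists d.
(* [d1] is the mesh needed for the winding numbers around the [z i], and r / 2 the one needed for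
   [turns_rectangle]. *)
pose d := Num.min d1 (r / 2).
have d0 : 0 < d by rewrite lt_min d10 /=; lra.
have dr2 : d <= r / 2 by rewrite ge_min lexx orbT.
have dr : d + d <= r by lra.
have /choice[sA hA] i := connected_chain (cA i) d0 (Aa i) (Az i).
have /choice[sB hB] i := connected_chain (cB i) d0 (Bz i) (Bb i).
pose n i j := swap_turns a b (z i) (sA i) (sB i) (z j) (sA j) (sB j).
have nC i j : i != j -> n i j (+) n j i.
  move=> ij; have [pai lai hai] := hA i; have [paj laj haj] := hA j.
  have [pbi lbi hbi] := hB i; have [pbj lbj hbj] := hB j.
  apply: (swap_turnsC d0 dr) => // u v hu hv.
    by apply: (hr (i, j)) => //; [exact: hai|exact: hbj].
  by rewrite close_sym; apply: (hr (j, i)); rewrite /= 1?eq_sym //;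
    [exact: haj|exact: hbi].
(* The moves of P_i are the same in both counts. The remaining chains follow P_j and P_k from [a] to
   [b] while P_i rests at [z i], and together they form a loop that does not wind around it. *)
have nE i j k : i != j -> i != k -> n i j = n i k.
  move=> ij ik; have [paj laj haj] := hA j; have [pbj lbj hbj] := hB j.
  have [pak lak hak] := hA k; have [pbk lbk hbk] := hB k.
  have wk (x0 : plane) s0 : path (close d) x0 s0 -> path (close d1) x0 s0.
    by move=> h; apply: path_close_le h _; rewrite ge_min lexx.
  have := hd1 (i, j, k) ij ik a (sA j ++ sB j) (sA k ++ sB k).
  rewrite !cat_path !last_cat !turns_cat laj lak !wk // lbj lbk => /(_ isT isT erefl).
  have mem l (x : plane) s t w : w \in x :: s ++ t -> w \in x :: s \/ w \in l :: t.
    rewrite -cat_cons mem_cat => /orP[->|h]; first by left.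
    by right; rewrite in_cons h orbT.
  move=> /(_ _ _)H; rewrite /n /swap_turns.
  have {}H : turns (from_point (z i)) a (sA j) (+) turns (from_point (z i)) (z j) (sB j) =
     turns (from_point (z i)) a (sA k) (+) turns (from_point (z i)) (z k) (sB k).
    apply: H => w.
      by move=> /(mem (z j))[/haj|/hbj] h; left; [left|right].
    by move=> /(mem (z k))[/hak|/hbk] h; right; [left|right].
  move: H; case: (turns _ a (sA j)) (turns _ (z j) _) (turns _ a (sA k))
    (turns _ (z k) _) => [] [] [] [] //;
      by case: (turns _ _ _) (turns _ _ _) => [] [].
pose i0 : 'I_3 := ord0; pose i1 : 'I_3 := inord 1; pose i2 : 'I_3 := ord_max.
have [n01 n02 n12] : [/\ i0 != i1, i0 != i2 & i1 != i2].
  by split; rewrite -val_eqE /= ?inordK.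
have [n10 n20 n21] : [/\ i1 != i0, i2 != i0 & i2 != i1].
  by split; rewrite eq_sym.
(* As [n i j] depends on [i] only, there would be three pairwise different booleans. *)
move: (nC _ _ n01) (nC _ _ n02) (nC _ _ n12).
rewrite (nE _ _ _ n01 n02) (nE _ _ _ n10 n12) (nE _ _ _ n20 n21).
by case: (n _ _) (n _ _) (n _ _) => [] [] [].
Qed.
End ThetaPlane.

(** * Paths of the graph as compact connected sets of the drawing *)

Section Drawing.
Local Open Scope classical_set_scope.
Local Open Scope ring_scope.
Variables (R : realType) (V : finType) (e : rel V).
Notation plane := (R * R)%type.
Variables (p : V -> plane) (A : V -> V -> set plane).
Hypothesis drawing : planar_drawing e p A.

Fixpoint route (x y : V) (s : seq V) : set plane :=
  if s is z :: s' then A x y `|` route y z s' else A x y.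

Lemma arc_compact x y : e x y -> compact (A x y).
Proof.
move=> /(drawing_edge_arc drawing)[f [cf _ _ _ <-]].
by apply: continuous_compact => //; apply: segment_compact.
Qed.

Lemma arc_connected x y : e x y -> connected (A x y).
Proof.
move=> /(drawing_edge_arc drawing)[f [cf _ _ _ <-]].
by apply: connected_continuous_connected => //; apply: segment_connected.
Qed.

Lemma arc_ends x y : e x y -> A x y (p x) /\ A x y (p y).
Proof.
move=> /(drawing_edge_arc drawing)[f [cf _ <- <- <-]].
by split; [exists 0|exists 1] => //=; rewrite in_itv /= ?lexx ?ler01.
Qed.

Lemma route_edge x y s q : path e x (y :: s) -> route x y s q ->
  exists u v, [/\ e u v, u \in x :: y :: s, v \in x :: y :: s & A u v q].
Proof.
elim: s x y => [|z s IH] x y /=.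
  by rewrite andbT => xy h; exists x, y; rewrite !inE !eqxx orbT.
move=> /andP[xy h] [Aq|/(IH _ _ h)[u [v [uv hu hv Aq]]]].
  by exists x, y; rewrite !inE !eqxx orbT.
by exists u, v; split=> //; rewrite in_cons (hu, hv) orbT.
Qed.

Lemma route_start x y s : path e x (y :: s) -> route x y s (p x).
Proof. by case: s => [|z s] /= /andP[/arc_ends[]]; [|left]. Qed.

Lemma route_last x y s : path e x (y :: s) -> route x y s (p (last y s)).
Proof.
elim: s x y => [|z s IH] x y /andP[xy h] /=; first by have [] := arc_ends xy.
by right; apply: IH.
Qed.

Lemma route_compact x y s : path e x (y :: s) -> compact (route x y s).
Proof.
elim: s x y => [|z s IH] x y /andP[xy h] /=; first exact: arc_compact.
by apply: compactU; [exact: arc_compact|exact: IH].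
Qed.

Lemma route_connected x y s : path e x (y :: s) -> connected (route x y s).
Proof.
elim: s x y => [|z s IH] x y /andP[xy h] /=; first exact: arc_connected.
apply: connectedU; last exact: IH; last exact: arc_connected.
by exists (p y); split; [have [] := arc_ends xy|exact: route_start].
Qed.

End Drawing.

(** Each path is cut at its first interior vertex [z i]: the first half is the single arc from [a],
    the second the union of the remaining arcs up to [b]. *)
Theorem outerplanar_no_theta (R : realType) (V : finType) (e : rel V) a b q :
  outerplanar R e -> ~ theta e a b q.
Proof.
move=> [p [A [dr [F [[w0 Dw0 FE] uF] clF]]]] [ab hq disj].
pose z i := head a (q i).
pose t i := rcons (behead (q i)) b.
have qE i : rcons (q i) b = z i :: t i.
  by have [+ _ _ _] := hq i; rewrite /z /t; case: (q i).
have zq i : z i \in q i.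
  by have [+ _ _ _] := hq i; rewrite /z; case: (q i) => //= x s _;
    exact: mem_head.
have tq i x : x \in t i -> x \in q i \/ x = b.
  rewrite mem_rcons in_cons => /orP[/eqP ->|/mem_behead]; by [right|left].
have pq i : path e a (z i :: t i) by rewrite -qE; have [] := hq i.
have eaz i : e a (z i) by have /andP[] := pq i.
pose u i := head a (t i).
pose s i := behead (t i).
have tE i : t i = u i :: s i by rewrite /u /s /t; case: (behead (q i)).
have pB i : path e (z i) (u i :: s i) by rewrite -tE; have /andP[] := pq i.
have FD w : F w -> ~ drawing_support e p A w.
  by rewrite FE => /connected_component_sub.
have FA w x y : F w -> e x y -> ~ A x y w.
  by move=> /FD Fw xy Aw; apply: Fw; right; exists x, y.
apply: (@theta_plane R (p a) (p b) (fun i => p (z i)) (fun i => A a (z i))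
  (fun i => route A (z i) (u i) (s i)) F) => //.
- move=> i. exact: (arc_compact dr (eaz i)).
- by move=> i; exact: (route_compact dr (pB i)).
- by move=> i; exact: (arc_connected dr (eaz i)).
- by move=> i; exact: (route_connected dr (pB i)).
- by move=> i; have [] := arc_ends dr (eaz i).
- by move=> i; have [] := arc_ends dr (eaz i).
- by move=> i; exact: (route_start dr (pB i)).
- move=> i; have := route_last dr (pB i).
  have -> // : last (u i) (s i) = b.
  by have := last_rcons a (behead (q i)) b; rewrite -/(t i) tE.
- move=> i j ij; apply/seteqP; split=> // w [Aw].
  move=> /(route_edge (pB j))[x [y [xy hx hy Aw']]].
  (* No vertex after [a] on the path [j] is an end of the edge from [a] to [z i]. Hence the two arcs
     belong to different edges without a common end, and such arcs do not meet. *)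
  have away v : v \in z j :: u j :: s j -> v \notin [set a; z i]%SET.
    have [_ _ ai bi] := hq i; have [_ _ aj bj] := hq j.
    rewrite -tE in_cons !inE => /orP[/eqP ->|/tq[vq|->]].
    + rewrite negb_or; apply/andP; split.
        by apply: contraNneq aj => <-.
      by apply: contraTneq (zq j) => ->; apply: disj (zq i).
    + rewrite negb_or; apply/andP; split.
        by apply: contraNneq aj => <-.
      by apply: contraTneq vq => ->; apply: disj (zq i).
    + rewrite negb_or eq_sym ab /=.
      by apply: contraNneq bi => ->.
  have [|v [vaz vxy _]] := drawing_edge_edge dr (eaz i) xy _ Aw Aw'.
    apply/eqP => /setP/(_ x); rewrite (negbTE (away x hx)) => /esym.
    by rewrite !inE eqxx.
  have : v \in z j :: u j :: s j by move: vxy; rewrite !inE => /orP[] /eqP ->.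
  by move=> /away; rewrite vaz.
- by rewrite FE; exact: component_connected.
- move=> i w Fw; split; first exact: FA.
  by move=> /(route_edge (pB i))[x [y [xy _ _]]]; exact: FA.
Qed.

Theorem theorem3p10 (R : realType) (V : finType) (e : rel V)
    (e_sym : symmetric e) (e_irr : irreflexive e) (e_outer : outerplanar R e) :
  outcome_D e <-> exists f : rel V, perfect_12_factor e f.
Proof.
split=> [/outcome_wins/(_ Staller) win|[f fac]].
  have noth a b p : ~ theta e a b p by exact: outerplanar_no_theta e_outer.
  have [sigma sinj esig] := wins_injection e_sym noth win.
  exact: injection_factor esig.
apply/outcome_wins => first; have [L cov] := factor_cycle_cover fac.
apply: (cycle_cover_wins e_sym _ _ _ cov).
  by rewrite finset.setU0 finset.setC0 finset.cardsT.
by rewrite finset.set0I.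
Qed.
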